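(* Let $G$ be a finite group, $p$ a prime, $N$ a normal $p$-subgroup of $G$, $\theta\in\operatorname{Irr}(N)$ a $G$-invariant character, and $B$ a $p$-block of $G$ with defect group $D$. (a) Suppose that some $\chi\in\operatorname{Irr}(B|\theta)$ has the same height as $\theta$. Then $\theta$ extends to $D$. (b) Assume that Conjecture A holds for all finite groups. If every character in $\operatorname{Irr}(B|\theta)$ has the same height as $\theta$, then $D/N$ is abelian.
   Context: For a $p$-block $B$ of $G$ with defect group $D$, the height $\mathrm{ht}(\chi)\ge0$ of $\chi\in\operatorname{Irr}(B)$ is defined by $\chi(1)_p=p^{\mathrm{ht}(\chi)}|G:D|_p$; since $N$ is a $p$-group, its unique block has defect group $N$ and the height of $\theta$ is $\log_p\theta(1)$. $\operatorname{Irr}(B|\theta)$ is the set of $\chi\in\operatorname{Irr}(B)$ such that $\theta$ is a constituent of $\chi_N$. (A normal $p$-subgroup $N$ is contained in every defect group $D$.) Conjecture A: for every finite group $H$, prime $p$, $p$-block $B'$ of $H$ with defect group $P$, central $p$-subgroup $Z\le H$ and $\lambda\in\operatorname{Irr}(Z)$, all characters of $\operatorname{Irr}(B'|\lambda)$ have height zero if and only if $P/Z$ is abelian and $\lambda$ extends to $P$. *)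

(* Defs.v *)
(* p-blocks, defect groups and heights are not in MathComp;
   they are defined here following Navarro, "Characters and Blocks of Finite
   Groups", Ch. 3-4, relative to a maximal ideal M of the ring of algebraic
   integers (Aint) of algC containing p. *)
From HB Require Import structures.
From mathcomp Require Import all_boot all_order all_algebra all_fingroup all_solvable all_field all_character.
Set Implicit Arguments. Unset Strict Implicit. Unset Printing Implicit Defensive.
Import GRing.Theory Num.Theory.
Local Open Scope group_scope.
Local Open Scope ring_scope.

Definition max_ideal_over (p : nat) (M : {pred algC}) : Prop :=
  [/\ {subset M <= Aint}, 0 \in M &
      (forall a b, a \in M -> b \in M -> a - b \in M)] /\
  [/\ (forall r a, r \in Aint -> a \in M -> r * a \in M),
      (p%:R : algC) \in M,
      (1 : algC) \notin M &
      (forall r, r \in Aint -> r \notin M ->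
          exists2 s, s \in Aint & r * s - 1 \in M)].

(* Reduction x^* is nonzero, for x in the localization S of Aint at M:
   x is a unit of S. *)
Definition nonzero_mod (M : {pred algC}) (x : algC) : Prop :=
  exists r s, [/\ r \in Aint, s \in Aint, r \notin M, s \notin M & x = r / s].

Section Blocks.
Variable gT : finGroupType.

(* central character value omega_chi(K^) for the class K of x *)
Definition omega (G : {group gT}) (i : Iirr G) (x : gT) : algC :=
  #|(x ^: G)%g|%:R * 'chi_i x / 'chi_i 1%g.

Definition same_block (M : {pred algC}) (G : {group gT}) (i j : Iirr G) : Prop :=
  forall x, x \in G -> omega i x - omega j x \in M.

Definition is_block (M : {pred algC}) (G : {group gT}) (B : {set Iirr G}) : Prop :=
  exists i, forall j, j \in B <-> same_block M i j.

(* coefficient a_B(K) of the class sum K^ (K the class of x) in the block idempotent *)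
Definition a_block (G : {group gT}) (B : {set Iirr G}) (x : gT) : algC :=
  \sum_(j in B) 'chi_j 1%g * 'chi_j (x^-1)%g / #|G|%:R.

(* D is a defect group of B: a Sylow p-subgroup of C_G(x) for x in a defect
   class K of B, i.e. lambda_B(K^) <> 0 and a_B(K) <> 0. *)
Definition is_defect_group (p : nat) (M : {pred algC}) (G : {group gT})
    (B : {set Iirr G}) (D : {group gT}) : Prop :=
  exists2 x, x \in G &
    [/\ (forall i, i \in B -> omega i x \notin M),
        nonzero_mod M (a_block B x) &
        D \in 'Syl_p('C_G[x])%g].

(* height of chi_i in a block with defect group D:
   chi(1)_p = p^ht |G:D|_p *)
Definition height (p : nat) (G D : {group gT}) (i : Iirr G) : nat :=
  (logn p (Num.truncn ('chi_i 1%g)) - logn p #|G : D|%g)%N.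

Definition irr_block_over (G N : {group gT}) (B : {set Iirr G}) (t : Iirr N) :
    {set Iirr G} :=
  [set j in B | (t \in irr_constt ('Res[N] 'chi_j))%CF].

Definition extends_to (N D : {group gT}) (lam : 'CF(N)) : Prop :=
  exists2 phi : 'CF(D), phi \in irr D & 'Res[N] phi = lam.

End Blocks.

Definition ConjectureA : Prop :=
  forall (hT : finGroupType) (H : {group hT}) (p : nat) (M : {pred algC})
         (B : {set Iirr H}) (P Z : {group hT}) (l : Iirr Z),
    prime p -> max_ideal_over p M -> is_block M B -> is_defect_group p M B P ->
    p.-group Z -> Z \subset 'Z(H) ->
    ((forall j, j \in irr_block_over B l -> height p P j = 0%N) <->
     (abelian (P / Z) /\ extends_to P 'chi_l)).

(* Main.v *)
Require Import Defs.
From HB Require Import structures.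
From mathcomp Require Import all_boot all_order all_algebra all_fingroup all_solvable all_field all_character.
From mathcomp Require Import ring.
Import Order.TTheory GRing.Theory Num.Theory.
Local Open Scope group_scope.
Local Open Scope ring_scope.
Set Implicit Arguments. Unset Strict Implicit. Unset Printing Implicit Defensive.

(**
Let S be the localization of the algebraic integers at M. Interpolating between
the central characters of the blocks and taking powers M-adically shows that the
block idempotent e_B has coefficients in S, and that it lies mod M in the ideal
generated by any class sum on which the central character of B does not vanish;
the Brauer homomorphism then gives the min-max principle for defect groups.
Since e_B S[G] is projective over every p-subgroup, e_B vanishes at nontrivial
p-elements, so each block has characters over every character of N; applied to
the trivial character of N this forces the central character of B to vanish
outside C_G(N), whence N <= D.

(a) Let x be in a defect class with D Sylow in C_G(x). If theta did not extend
to D, all constituents of chi restricted to D <x> would have degree divisible by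
p theta(1), so chi(x) would be too divisible by p for omega_chi(x) to be a unit.

(b) The pairs (g, A), with A a matrix of suitable determinant intertwining
theta with its conjugate by g, form a finite central extension H of G by a
p-group, in which N lifts to a normal subgroup K and theta extends to a
character eta of H. By Gallagher, chi = eta beta matches Irr(G|theta) with the
characters of H/K over a character of a central p-subgroup Z. For f(x) in C_G(N)
the central characters of chi and beta agree up to an algebraic integer and the
index of the centralizers, so blocks of H/K map into blocks of G, and the
preimage of D in H/K is a defect group of a block to which Conjecture A applies.
*)

(* The localization of the algebraic integers at M, and its maximal ideal. *)
Definition locR (M : {pred algC}) (x : algC) : Prop :=
  exists r s, [/\ r \in Aint, s \in Aint, s \notin M & x = r / s].

Definition locJ (M : {pred algC}) (x : algC) : Prop :=
  exists r s, [/\ r \in M, s \in Aint, s \notin M & x = r / s].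

(** * Arithmetic of the localization of the algebraic integers at [M] *)

Section Localization.

Variables (p : nat) (M : {pred algC}).
Hypotheses (p_pr : prime p) (maxM : max_ideal_over p M).

Lemma M_Aint : {subset M <= Aint}. Proof. by case: maxM => [[]]. Qed.
Lemma M0 : 0 \in M. Proof. by case: maxM => [[]]. Qed.
Lemma MB a b : a \in M -> b \in M -> a - b \in M.
Proof. by case: maxM => [[_ _ +] _]; apply. Qed.
Lemma MMl r a : r \in Aint -> a \in M -> r * a \in M.
Proof. by case: maxM => [_ [+ _ _ _]]; apply. Qed.
Lemma MMr r a : r \in Aint -> a \in M -> a * r \in M.
Proof. by rewrite mulrC; apply: MMl. Qed.
Lemma Mp : p%:R \in M. Proof. by case: maxM => [_ []]. Qed.
Lemma M1 : 1 \notin M. Proof. by case: maxM => [_ []]. Qed.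
Lemma MN a : a \in M -> - a \in M.
Proof. by move=> Ma; rewrite -sub0r MB ?M0. Qed.
Lemma MD a b : a \in M -> b \in M -> a + b \in M.
Proof. by move=> Ma Mb; rewrite -[b]opprK MB ?MN. Qed.

Lemma M_sum (I : Type) (r : seq I) (P : pred I) (F : I -> algC) :
  (forall i, P i -> F i \in M) -> \sum_(i <- r | P i) F i \in M.
Proof. by move=> MF; elim/big_ind: _ => //; [apply: M0 | apply: MD]. Qed.

Lemma M_congr a b : a - b \in M -> (a \in M) = (b \in M).
Proof.
move=> Mab; apply/idP/idP => [Ma|Mb]; last by rewrite -(subrK b a) MD.
by rewrite -[b](subKr a) MB.
Qed.

(** For [r] outside [M] take [t] inverse to [r] modulo [M]; then s = t(rs) - (rt - 1)s. *)
Lemma M_prime r s : r \in Aint -> s \in Aint -> r * s \in M ->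
  (r \in M) || (s \in M).
Proof.
move=> Ar As Mrs; have [//|nMr] := boolP (r \in M).
case: maxM => [_ [_ _ _ /(_ r Ar nMr)[t At Mt]]] /=.
have: t * (r * s) - (r * t - 1) * s \in M by apply: MB; [apply: MMl | apply: MMr].
by have -> : t * (r * s) - (r * t - 1) * s = s by ring.
Qed.

Lemma notMM r s : r \in Aint -> s \in Aint -> r \notin M -> s \notin M ->
  r * s \notin M.
Proof.
by move=> Ar As nr ns; apply/negP => /(M_prime Ar As); rewrite (negPf nr) (negPf ns).
Qed.

Lemma notM_neq0 s : s \notin M -> s != 0.
Proof. by apply: contraNneq => ->; apply: M0. Qed.

Lemma Aint_natr n : n%:R \in Aint.
Proof. by rewrite Aint_Cnat ?natr_nat. Qed.

(** An integer prime to [p] lying in [M] would put 1 in [M], by Bezout. *)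
Lemma M_natr n : (n%:R \in M) = (p %| n)%N.
Proof.
apply/idP/idP => [Mn|/dvdnP[k ->]]; last by rewrite natrM MMl ?Mp ?Aint_natr.
apply: contraLR M1 => p'n; have n_gt0 : (n > 0)%N by case: n p'n {Mn}; rewrite ?dvdn0.
rewrite negbK; have [u v Duv _] := egcdnP p n_gt0.
have: (u * n)%:R - (v * p)%:R \in M.
  by rewrite !natrM MB ?MMl ?Aint_natr ?Mp.
rewrite Duv natrD addrAC subrr add0r; suff -> : gcdn n p = 1%N by [].
by apply/eqP; rewrite -/(coprime n p) coprime_sym prime_coprime.
Qed.

Lemma M_intr (z : int) : (z%:~R \in M) = (p %| z)%Z.
Proof.
rewrite dvdzE absz_nat -M_natr; case: (intP z) => [|n|n] //=.
by rewrite mulrNz; apply/idP/idP => /MN; rewrite ?opprK.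
Qed.

Lemma locR_Aint r : r \in Aint -> locR M r.
Proof. by move=> Ar; exists r, 1; rewrite Aint1 M1 divr1. Qed.

Lemma locJ_M r : r \in M -> locJ M r.
Proof. by move=> Ar; exists r, 1; rewrite Aint1 M1 divr1. Qed.

Lemma M_locJ r : r \in Aint -> locJ M r -> r \in M.
Proof.
move=> Ar [m [s [Mm As nMs Dr]]]; have nz_s := notM_neq0 nMs.
have: r * s \in M by rewrite Dr divfK.
by move/(M_prime Ar As); rewrite (negPf nMs) orbF.
Qed.

Lemma locJ_R x : locJ M x -> locR M x.
Proof. by move=> [r [s [/M_Aint Mr As nMs Dx]]]; exists r, s. Qed.

Lemma locRD x y : locR M x -> locR M y -> locR M (x + y).
Proof.
move=> [r [s [Ar As ns ->]]] [r' [s' [Ar' As' ns' ->]]].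
exists (r * s' + r' * s), (s * s'); split; rewrite ?rpredD ?rpredM ?notMM //.
by rewrite addf_div // notM_neq0.
Qed.

Lemma locRM x y : locR M x -> locR M y -> locR M (x * y).
Proof.
move=> [r [s [Ar As ns ->]]] [r' [s' [Ar' As' ns' ->]]].
by exists (r * r'), (s * s'); split; rewrite ?rpredM ?notMM ?mulf_div.
Qed.

Lemma locJD x y : locJ M x -> locJ M y -> locJ M (x + y).
Proof.
move=> [r [s [Ar As ns ->]]] [r' [s' [Ar' As' ns' ->]]].
exists (r * s' + r' * s), (s * s').
split; rewrite ?rpredM ?notMM //; first by rewrite MD // MMr.
by rewrite addf_div // notM_neq0.
Qed.

Lemma locJMl x y : locR M x -> locJ M y -> locJ M (x * y).
Proof.
move=> [r [s [Ar As ns ->]]] [r' [s' [Ar' As' ns' ->]]].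
exists (r * r'), (s * s').
by split; [apply: MMl | rewrite rpredM | apply: notMM | rewrite mulf_div].
Qed.

Lemma locJMr x y : locR M x -> locJ M y -> locJ M (y * x).
Proof. by rewrite mulrC; apply: locJMl. Qed.

Lemma locJN x : locJ M x -> locJ M (- x).
Proof. by rewrite -mulN1r; apply: locJMl; apply: locR_Aint; rewrite rpredN Aint1. Qed.

Lemma locR_sum (I : Type) (r : seq I) (P : pred I) (F : I -> algC) :
  (forall i, P i -> locR M (F i)) -> locR M (\sum_(i <- r | P i) F i).
Proof.
by move=> MF; elim/big_ind: _ => //; [apply: locR_Aint Aint0 | apply: locRD].
Qed.

Lemma locJ_sum (I : Type) (r : seq I) (P : pred I) (F : I -> algC) :
  (forall i, P i -> locJ M (F i)) -> locJ M (\sum_(i <- r | P i) F i).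
Proof. by move=> MF; elim/big_ind: _ => //; [apply: locJ_M M0 | apply: locJD]. Qed.

Lemma locRX x n : locR M x -> locR M (x ^+ n).
Proof.
move=> Rx; elim: n => [|n IHn]; first exact: locR_Aint Aint1.
by rewrite exprS; apply: locRM.
Qed.

Lemma locR_nat n : locR M n%:R.
Proof. by apply: locR_Aint; apply: Aint_natr. Qed.

Lemma locJ1 : ~ locJ M 1.
Proof. by move/(M_locJ Aint1); apply/negP/M1. Qed.

Lemma nonzero_modP x : nonzero_mod M x <-> locR M x /\ ~ locJ M x.
Proof.
split=> [[r [s [Ar As nr ns ->]]] | [[r [s [Ar As ns Dx]]] Jx]].
  split; first by exists r, s.
  move=> Jrs; have: locJ M (r / s * s) by apply: locJMr => //; apply: locR_Aint.
  by rewrite divfK ?notM_neq0 // => /(M_locJ Ar); apply/negP.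
exists r, s; split=> //; apply/negP => Mr; case: Jx.
by exists r, s.
Qed.

(* The first coefficient prime to [p] of an integral polynomial killing [r]
   isolates a power of [r]. *)
Lemma M_pow_dvdp r : r \in M ->
  exists k u, locR M u /\ r ^+ k = p%:R * u.
Proof.
move=> Mr; have Ar := M_Aint Mr.
have [q Dq] := floorpP (Ar : minCpoly r \is a polyOver Num.int).
have mon_q : q \is monic.
  have := minCpoly_monic r; rewrite Dq !monicE lead_coef_map_inj //; last exact: intr_inj.
  by move/eqP=> Dlq; apply/eqP/(@intr_inj algC).
have rq : \sum_(i < size q) (q`_i)%:~R * r ^+ i = 0.
  have /rootP := root_minCpoly r; rewrite Dq horner_coef size_map_inj_poly //; last exact: intr_inj.
  by under eq_bigr do rewrite coef_map.
have [|k pk min_k] := @ex_minnP (fun k => ~~ (p %| q`_k)%Z).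
  exists (size q).-1; rewrite -/(lead_coef q) (monicP mon_q) dvdzE /=.
  by rewrite dvdn1; case: eqP p_pr => // ->.
(* Below index [k] all coefficients are divisible by [p], and [v] is a unit because it is congruent
   modulo [M] to the coefficient of index [k]. With [a] as below, the equation of [r] reads r^k v =
   - p a. *)
pose v := \sum_(i < size q - k) (q`_(k + i))%:~R * r ^+ i.
have k_lt : (k < size q)%N.
  by rewrite ltnNge; apply: contra pk => /(nth_default _) ->; rewrite dvdz0.
have Av : v \in Aint by rewrite rpred_sum // => i _; rewrite rpredM ?rpredX ?Aint_int.
have nMv : v \notin M.
  rewrite /v; case Dn: (size q - k)%N => [|n].
    by move: k_lt; rewrite -subn_gt0 Dn.
  rewrite big_ord_recl /= addn0 expr0 mulr1.
  set w := \sum_i _; rewrite (@M_congr _ (q`_k)%:~R) ?M_intr //.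
  rewrite addrAC subrr add0r M_sum // => i _; rewrite exprS mulrCA MMr //.
  by rewrite rpredM ?rpredX ?Aint_int.
pose a := \sum_(i < k) (q`_i %/ p)%Z%:~R * r ^+ i.
have Aa : a \in Aint by rewrite rpred_sum // => i _; rewrite rpredM ?rpredX ?Aint_int.
exists k, (- a / v); split; first by exists (- a), v; rewrite rpredN.
apply: (mulIf (notM_neq0 nMv)); rewrite mulrA divfK ?notM_neq0 //.
apply/eqP; rewrite mulrN -addr_eq0 -{}rq addrC; apply/eqP.
rewrite -(subnKC (ltnW k_lt)) big_split_ord /=; congr (_ + _).
  rewrite mulr_sumr; apply: eq_bigr => i _; rewrite mulrA; congr (_ * _).
  rewrite pmulrn -intrM mulrC divzK //.
  by apply: contraLR (ltn_ord i) => /min_k; rewrite -leqNgt.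
by rewrite mulr_sumr; apply: eq_bigr => i _; rewrite exprD mulrCA.
Qed.

(** If r^k is a multiple of [p] in the localization and p^a is the p-part of [n], then k(a + 1)
    factors [r] cancel p^a and leave one spare factor [p], which lies in [M]. *)
Lemma M_pow_div r n : r \in M -> (n > 0)%N ->
  exists k, forall m, (k <= m)%N -> locJ M (r ^+ m / n%:R).
Proof.
move=> Mr n_gt0; have [k [u [Ru Dr]]] := M_pow_dvdp Mr.
pose a := logn p n; exists (k * a.+1)%N => m le_m.
have [m' p'm' Dn] : {m' | ~~ (p %| m')%N & n = (m' * p ^ a)%N}.
  have [m' co Dn] := pfactor_coprime p_pr n_gt0.
  by exists m' => //; rewrite -prime_coprime.
have nMm' : m'%:R \notin M by rewrite M_natr.
have nzp : (p%:R : algC) != 0 by rewrite pnatr_eq0 -lt0n prime_gt0.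
have -> : r ^+ m / n%:R = p%:R * (r ^+ (m - k * a.+1) * u ^+ a.+1 * m'%:R^-1).
  rewrite -{1}(subnKC le_m) exprD exprM Dr exprMn Dn natrM natrX !exprS.
  by field; rewrite expf_neq0 // notM_neq0.
apply: locJMr; last exact: locJ_M Mp.
apply: locRM; first by apply: locRM; apply: locRX => //; apply: locR_Aint; apply: M_Aint.
by exists 1, m'%:R; rewrite Aint1 Aint_natr nMm' div1r.
Qed.
End Localization.

(** * The center of the group algebra through central characters *)

Section ClassCoefficients.

Variables (gT : finGroupType) (G : {group gT}).
Implicit Types (w : Iirr G -> algC).

(* The coefficient at x of the element of Z(C[G]) on which the central
   character of chi_i takes the value w i. *)
Definition class_coef w (x : gT) : algC :=
  \sum_i w i * ('chi_i 1%g * 'chi_i (x^-1)%g / #|G|%:R).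

(** Central elements multiply pointwise on central characters and by convolution on coefficients;
    generalized orthogonality removes the cross terms between distinct characters. *)
Lemma class_coefM w1 w2 x : x \in G ->
  class_coef (fun i => w1 i * w2 i) x
    = \sum_(y in G) class_coef w1 y * class_coef w2 (y^-1 * x)%g.
Proof.
move=> Gx; pose c i := 'chi[G]_i 1%g / #|G|%:R.
have nzG : (#|G|%:R : algC) != 0 by rewrite pnatr_eq0 -lt0n cardG_gt0.
transitivity (\sum_i \sum_j (w1 i * c i) * (w2 j * c j) *
   \sum_(y in G) 'chi_j (y * x^-1)%g * 'chi_i y^-1%g); last first.
  under [RHS]eq_bigr => y Gy.
    rewrite big_distrlr /=; over.
  rewrite [RHS]exchange_big; apply: eq_bigr => i _ /=.
  rewrite [RHS]exchange_big; apply: eq_bigr => j _ /=.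
  rewrite mulr_sumr; apply: eq_bigr => y Gy.
  rewrite invMg invgK -(cfunJ 'chi_j (x^-1 * y)%g (groupVr Gx)).
  by rewrite conjgE invgK !mulgA mulgV mul1g /c; ring.
apply: eq_bigr => i _; rewrite (bigD1 i) //= [X in _ + X]big1 => [|j ji].
  have := generalized_orthogonality_relation x^-1 i i; rewrite eqxx mul1r.
  move/(canRL (mulKf (invr_neq0 nzG))); rewrite invrK => ->.
  by rewrite addr0 /c; field; rewrite nzG irr1_neq0.
have := generalized_orthogonality_relation x^-1 j i; rewrite (negPf ji) mul0r.
by move/eqP; rewrite mulf_eq0 invr_eq0 (negPf nzG) /= => /eqP ->; rewrite mulr0.
Qed.

Lemma class_coefD w1 w2 x : class_coef (fun i => w1 i + w2 i) x = class_coef w1 x + class_coef w2 x.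
Proof. by rewrite -big_split; apply: eq_bigr => i _; rewrite mulrDl. Qed.

Lemma class_coefJ w x y : y \in G -> class_coef w (x ^ y)%g = class_coef w x.
Proof. by move=> Gy; apply: eq_bigr => i _; rewrite -conjVg cfunJ. Qed.

(** The values [omega i h] represent the class sum of [h], whose coefficients second orthogonality
    recovers. *)
Lemma class_coef_omega h x : h \in G -> x \in G ->
  class_coef (fun i => omega i h) x = (h \in x ^: G)%:R.
Proof.
move=> Gh Gx; have nzG : (#|G|%:R : algC) != 0 by rewrite pnatr_eq0 -lt0n cardG_gt0.
transitivity (#|h ^: G|%:R / #|G|%:R * \sum_i 'chi[G]_i h * ('chi_i x)^*).
  rewrite mulr_sumr; apply: eq_bigr => i _; rewrite (char_inv _ (irr_char i)) /omega.
  by field; rewrite nzG irr1_neq0.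
rewrite second_orthogonality_relation // -[_ *+ (h \in _)]mulr_natr mulrA.
by rewrite [_ / _ * _]mulrAC -natrM -index_cent1 mulnC (Lagrange (subsetIl G 'C[h])) divff ?mul1r.
Qed.

Lemma omega1 (i : Iirr G) : omega i 1%g = 1.
Proof. by rewrite /omega class1G cards1 mul1r divff // irr1_neq0. Qed.

Lemma class_coefZ c w x : class_coef (fun i => c * w i) x = c * class_coef w x.
Proof. by rewrite mulr_sumr; apply: eq_bigr => i _; rewrite [RHS]mulrA. Qed.

Lemma class_coef_cst c x : x \in G -> class_coef (fun=> c) x = c * (x == 1%g)%:R.
Proof.
move=> Gx; have := class_coef_omega (group1 G) Gx.
rewrite class_sym class1G inE => <-; rewrite -class_coefZ.
by apply: eq_bigr => i _; rewrite omega1 mulr1.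
Qed.

Lemma a_blockE (B : {set Iirr G}) x : a_block B x = class_coef (fun i => (i \in B)%:R) x.
Proof.
rewrite /a_block big_mkcond; apply: eq_bigr => i _.
by case: (i \in B); rewrite ?mul1r ?mul0r.
Qed.

Lemma a_blockJ (B : {set Iirr G}) x y : y \in G -> a_block B (x ^ y)%g = a_block B x.
Proof. by move=> Gy; rewrite !a_blockE class_coefJ. Qed.

(** This is the idempotency of e_B: the indicator function of [B] is its own square. *)
Lemma a_blockM (B : {set Iirr G}) x : x \in G ->
  \sum_(y in G) a_block B y * a_block B (y^-1 * x)%g = a_block B x.
Proof.
move=> Gx; rewrite [RHS]a_blockE.
transitivity (class_coef (fun i => (i \in B)%:R * (i \in B)%:R) x).
  by rewrite class_coefM //; apply: eq_bigr => y _; rewrite !a_blockE.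
by apply: eq_bigr => i _; rewrite -natrM mulnb andbb.
Qed.

Lemma omega_Aint (i : Iirr G) x : x \in G -> omega i x \in Aint.
Proof. exact: Aint_class_div_irr1. Qed.

End ClassCoefficients.

(** * Block idempotents, the Brauer homomorphism and defect classes *)

Section BlockIdempotents.

Variables (p : nat) (M : {pred algC}).
Hypotheses (p_pr : prime p) (maxM : max_ideal_over p M).
Variables (gT : finGroupType) (G : {group gT}).
Implicit Types (w : Iirr G -> algC) (P : {group gT}) (B : {set Iirr G}).

(** Conjugation by [P] has no fixed point on [A], so each orbit has length divisible by [p], and [F]
    is constant on it. *)
Lemma locJ_sum_not_fixed P (A : {set gT}) (F : gT -> algC) :
  p.-group P -> P \subset 'N(A) -> [disjoint A & 'C(P)] ->
  (forall y, y \in A -> locR M (F y)) ->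
  (forall y a, y \in A -> a \in P -> F (y ^ a)%g = F y) ->
  locJ M (\sum_(y in A) F y).
Proof.
move=> pP nAP dAC RF FJ.
have actsP : [acts P, on A | 'J] by rewrite astabsJ.
rewrite (set_partition_big _ (orbit_partition actsP)) /=.
apply: (locJ_sum maxM) => // _ /imsetP[y Ay ->].
rewrite (eq_bigr (fun=> F y)) => [|_ /orbitP[a Pa <-]]; last by rewrite FJ.
rewrite sumr_const -mulr_natr; apply: (locJMl maxM); first exact: RF.
apply: (locJ_M maxM) => //; rewrite (M_natr p_pr maxM) card_orbit.
have [k Dk] := p_natP (pnat_dvd (dvdn_indexg P 'C_P[y | 'J]%G) pP).
rewrite /= in Dk; case: k Dk => [|k ->]; last by rewrite expnS dvdn_mulr.
move/eqP; rewrite expn0 indexg_eq1 => sPC; have/negP[] := negbT (disjointFr dAC Ay).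
apply/centP=> a /(subsetP sPC) /setIP[_ /astab1P /= ya].
by rewrite /commute conjgC ya.
Qed.

(** Describes the center of S[G], S the localization at [M], by central character values. *)
Definition loc_coef w := forall x, x \in G -> locR M (class_coef w x).

(* The kernel of the Brauer homomorphism at P. *)
Definition brauer_ker P w := loc_coef w /\ forall x, x \in 'C_G(P) -> locJ M (class_coef w x).

Lemma loc_coefM w1 w2 : loc_coef w1 -> loc_coef w2 -> loc_coef (fun i => w1 i * w2 i).
Proof.
move=> R1 R2 x Gx; rewrite class_coefM //; apply: (locR_sum maxM) => // y Gy.
by apply: (locRM maxM) => //; [apply: R1 | apply: R2; rewrite groupM ?groupV].
Qed.

Lemma loc_coefD w1 w2 : loc_coef w1 -> loc_coef w2 -> loc_coef (fun i => w1 i + w2 i).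
Proof. by move=> R1 R2 x Gx; rewrite class_coefD; apply: (locRD maxM); [apply: R1|apply: R2]. Qed.

Lemma loc_coef_cst c : c \in Aint -> loc_coef (fun=> c).
Proof.
move=> Ac x Gx; rewrite class_coef_cst //; apply: (locR_Aint maxM) => //.
by rewrite rpredM ?Aint_natr.
Qed.

Lemma loc_coef_omega h : h \in G -> loc_coef (fun i => omega i h).
Proof. by move=> Gh x Gx; rewrite class_coef_omega //; apply: (locR_nat maxM). Qed.

Lemma loc_coefX w m : loc_coef w -> loc_coef (fun i => w i ^+ m).
Proof.
move=> Rw; elim: m => [|m IHm]; first exact: loc_coef_cst Aint1.
have Rm := loc_coefM Rw IHm; move=> x Gx; have := Rm x Gx; rewrite /class_coef.
by under eq_bigr do rewrite -exprS.
Qed.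

Lemma loc_coef_prod (I : Type) (r : seq I) (Q : pred I) (F : I -> Iirr G -> algC) :
  (forall i, Q i -> loc_coef (F i)) -> loc_coef (fun j => \prod_(i <- r | Q i) F i j).
Proof.
move=> RF; elim: r => [|i r IHr] x Gx.
  have := loc_coef_cst Aint1 Gx; rewrite /class_coef.
  by under [X in _ -> locR M X]eq_bigr do rewrite big_nil.
have := IHr x Gx; rewrite /class_coef; have [Qi|nQi] := boolP (Q i); last first.
  by under [X in _ -> locR M X]eq_bigr do rewrite big_cons (negPf nQi).
move=> _; have := loc_coefM (RF i Qi) IHr Gx; rewrite /class_coef.
by under [X in _ -> locR M X]eq_bigr do rewrite big_cons Qi.
Qed.

(** In the convolution at [x] centralizing [P], the terms with [y] in C(P) are small because of
    [w1]; the others are permuted by [P] without fixed points. *)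
Lemma brauer_kerM P w1 w2 : p.-group P -> P \subset G ->
  brauer_ker P w1 -> loc_coef w2 -> brauer_ker P (fun i => w1 i * w2 i).
Proof.
move=> pP sPG [R1 V1] R2; split; first exact: loc_coefM.
move=> x /setIP[Gx Cx]; rewrite class_coefM // (big_setID 'C(P)) /=; apply: (locJD maxM) => //.
  apply: (locJ_sum maxM) => // y /setIP[Gy Cy]; apply: (locJMr maxM) => //.
    by apply: R2; rewrite groupM ?groupV.
  by apply: V1; rewrite inE Gy.
apply: (@locJ_sum_not_fixed P) => //.
- by apply: normsD; [apply: normsG | apply: norms_cent (normG P)].
- by rewrite disjoints_subset subDset setUCr subsetT.
- move=> y /setDP[Gy _].
  by apply: (locRM maxM) => //; [apply: R1 | apply: R2; rewrite groupM ?groupV].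
move=> y a _ Pa; have Ga := subsetP sPG a Pa; rewrite class_coefJ //; congr (_ * _).
suff -> : ((y ^ a)^-1 * x = (y^-1 * x) ^ a)%g by rewrite class_coefJ.
rewrite conjMg conjVg; congr (_ * _)%g.
by rewrite conjgE (centP Cx a Pa) mulKg.
Qed.

Lemma M_congrM a b c d : a \in Aint -> d \in Aint -> a - b \in M -> c - d \in M ->
  a * c - b * d \in M.
Proof.
move=> Aa Ad Mab Mcd; have -> : a * c - b * d = a * (c - d) + (a - b) * d by ring.
by apply: (MD maxM) => //; [apply: (MMl maxM) | apply: (MMr maxM)].
Qed.

Lemma same_block_refl (i : Iirr G) : same_block M i i.
Proof. by move=> x _; rewrite subrr; apply: (M0 maxM). Qed.

Lemma same_block_sym (i j : Iirr G) : same_block M i j -> same_block M j i.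
Proof. by move=> ij x /ij /(MN maxM); rewrite opprB. Qed.

Lemma same_block_trans (i j k : Iirr G) :
  same_block M i j -> same_block M j k -> same_block M i k.
Proof. by move=> ij jk x Gx; have := MD maxM (ij x Gx) (jk x Gx); rewrite addrA subrK. Qed.

Lemma block_same B i j : is_block M B -> i \in B -> j \in B <-> same_block M i j.
Proof.
move=> [i0 DB] /DB i0i; split=> [/DB i0j | ij]; last first.
  by apply/DB; apply: same_block_trans ij.
exact: same_block_trans (same_block_sym i0i) i0j.
Qed.

Lemma block_nonempty B : is_block M B -> exists i, i \in B.
Proof. by move=> [i DB]; exists i; apply/DB/same_block_refl. Qed.

Definition block_of (i : Iirr G) : {set Iirr G} :=
  [set j | [forall x in G, omega i x - omega j x \in M]].

Lemma block_ofP i : is_block M (block_of i).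
Proof. by exists i => j; rewrite inE; split=> [/forall_inP | ij]; last exact/forall_inP. Qed.

Lemma mem_block_of i : i \in block_of i.
Proof. by rewrite inE; apply/forall_inP/same_block_refl. Qed.

(* An integral central element acting as 0 outside B and as 1 mod M on B,
   lying in the ideal generated by the class sum of h. *)
Lemma block_separate B i0 h : is_block M B -> i0 \in B -> h \in G ->
    omega i0 h \notin M ->
  exists w', let w i := omega i h * w' i in
    [/\ loc_coef w', forall j, j \notin B -> w j = 0 &
        forall j, j \in B -> 1 - w j \in M].
Proof.
move=> blB Bi0 Gh nMh.
(* For [i] outside [B], [xs i] separates the central characters of [i0] and [i] modulo [M]; the
   default 1 is reached only for [i] in [B]. *)
pose xs (i : Iirr G) := odflt 1%g [pick x in G | omega i0 x - omega i x \notin M].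
have Gxs i : xs i \in G by rewrite /xs; case: pickP => [x /andP[]|] //=.
have xsP i : i \notin B -> omega i0 (xs i) - omega i (xs i) \notin M.
  move=> nBi; rewrite /xs; case: pickP => [x /andP[]|nox] //=.
  case/negP: nBi; apply/(block_same _ blB Bi0) => x Gx.
  by have:= nox x; rewrite Gx /= => /negbFE.
(* This interpolating product vanishes at every [j] outside [B], and is nonzero modulo [M] at [i0]
   because [M] is prime. *)
pose u (j : Iirr G) := \prod_(i | i \notin B) (omega j (xs i) - omega i (xs i)).
have Au j : u j \in Aint by rewrite rpred_prod // => i _; rewrite rpredB ?omega_Aint.
have nMu : u i0 \notin M.
  apply: (@proj2 (u i0 \in Aint)); rewrite /u; elim/big_ind: _ => [|a b [Aa na] [Ab nb]|i].
  - by rewrite Aint1 (M1 maxM).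
  - by rewrite rpredM //; split=> //; apply: (notMM maxM).
  by move=> nBi; rewrite rpredB ?omega_Aint //; split=> //; apply: xsP.
have Ah j := omega_Aint j Gh.
have [c Ac Mc] : exists2 c, c \in Aint & omega i0 h * u i0 * c - 1 \in M.
  by case: maxM => [_ [_ _ _ invM]]; apply: invM; [rewrite rpredM | apply: (notMM maxM)].
exists (fun i => u i * c); split.
- apply: loc_coefM; last exact: loc_coef_cst.
  by apply: loc_coef_prod => i _; apply: loc_coefD; [apply: loc_coef_omega | apply: loc_coef_cst; rewrite rpredN omega_Aint].
- by move=> j nBj; rewrite /u (bigD1 j) //= subrr !mul0r mulr0.
move=> j Bj; have := Bj; move/(block_same _ blB Bi0) => ij.
have Mu : u i0 - u j \in M.
  apply: (@proj2 (u i0 \in Aint /\ u j \in Aint)); rewrite /u.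
  elim/big_rec2: _ => [|i a b nBi [[Aa Ab] Mab]]; first by rewrite subrr (M0 maxM).
  split; first by rewrite !rpredM ?rpredB ?omega_Aint.
  apply: M_congrM; rewrite ?rpredB ?omega_Aint //.
  by rewrite opprB addrA subrK; apply: ij.
have: omega i0 h * (u i0 * c) - omega j h * (u j * c) \in M.
  apply: M_congrM; [exact: Ah | by rewrite rpredM | exact: ij |].
  by rewrite -mulrBl; apply: (MMr maxM).
move=> Mij; have -> : 1 - omega j h * (u j * c)
    = omega i0 h * (u i0 * c) - omega j h * (u j * c) - (omega i0 h * u i0 * c - 1) by ring.
by have := MB maxM Mij Mc.
Qed.

(** Take w from [block_separate]. Then 1 - (1 - w)^m is 0 outside [B] and differs from 1 on [B] by
    (1 - w)^m, which for large m is small even after division by |G|. *)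
Lemma block_idem_approx B i0 h : is_block M B -> i0 \in B -> h \in G ->
    omega i0 h \notin M ->
  exists w, loc_coef w /\
    let v i := omega i h * w i in
    forall x, locJ M (a_block B x - class_coef v x).
Proof.
move=> blB Bi0 Gh nMh; have [w' [Rw' w0 w1]] := block_separate blB Bi0 Gh nMh.
pose w i := omega i h * w' i.
have Rw : loc_coef w by apply: loc_coefM => //; apply: loc_coef_omega.
have [m Jm] : exists m, forall j, j \in B -> locJ M ((1 - w j) ^+ m / #|G|%:R).
  have: forall j : Iirr G, exists k, j \in B ->
      forall m, (k <= m)%N -> locJ M ((1 - w j) ^+ m / #|G|%:R).
    move=> j; have [Bj|] := boolP (j \in B); last by exists 0%N.
    by have [k kP] := M_pow_div p_pr maxM (w1 j Bj) (cardG_gt0 G); exists k.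
  case/fin_all_exists => k kP; exists (\max_j k j) => j Bj.
  by apply: (kP j Bj); apply: leq_bigmax.
(* The geometric sum is the quotient of 1 - (1 - w)^m by w, so the approximation stays a multiple of
   the class sum of [h]. *)
exists (fun i => w' i * \sum_(k < m) (1 - w i) ^+ k); split.
  apply: loc_coefM => //; elim: m {Jm} => [|m IHm] x Gx.
    have := loc_coef_cst Aint0 Gx; rewrite /class_coef.
    by under [X in _ -> locR M X]eq_bigr do rewrite big_ord0.
  have R1w : loc_coef (fun i => 1 - w i).
    apply: loc_coefD; first exact: loc_coef_cst Aint1.
    have AN1 : - 1 \in Aint by rewrite rpredN Aint1.
    have := loc_coefM (loc_coef_cst AN1) Rw => RN y /RN; rewrite /class_coef.
    by under eq_bigr do rewrite mulN1r.
  have := loc_coefD IHm (loc_coefX m R1w) Gx; rewrite /class_coef.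
  by under [X in _ -> locR M X]eq_bigr do rewrite big_ord_recr.
have Dv i : omega i h * (w' i * \sum_(k < m) (1 - w i) ^+ k) = 1 - (1 - w i) ^+ m.
  rewrite mulrA -/(w i); have := subrXX 1 (1 - w i) m; rewrite expr1n subKr => ->.
  by congr (_ * _); apply: eq_bigr => k _; rewrite expr1n mul1r.
move=> v x; rewrite a_blockE /class_coef -sumrB; apply: (locJ_sum maxM) => // j _.
rewrite -mulrBl /v Dv; have [Bj|nBj] := boolP (j \in B); last first.
  by rewrite /w w0 // subr0 expr1n subrr subr0 mul0r; apply: (locJ_M maxM) => //; apply: (M0 maxM).
rewrite subKr mulrCA; apply: (locJMl maxM); last exact: Jm.
by apply: (locR_Aint maxM); rewrite rpredM ?Aint_irr.
Qed.

(** The approximation applies with [h] = 1, where every central character is 1. *)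
Lemma a_block_locR B x : is_block M B -> x \in G -> locR M (a_block B x).
Proof.
move=> blB Gx; have [i0 Bi0] := block_nonempty blB.
have nM1 : omega i0 1%g \notin M by rewrite omega1 (M1 maxM).
have [w [Rw /(_ x) Jx]] := block_idem_approx blB Bi0 (group1 G) nM1.
rewrite -(subrK (class_coef (fun i => omega i 1%g * w i) x) (a_block B x)).
apply: (locRD maxM) => //; first exact: (locJ_R maxM).
by apply: loc_coefM => //; apply: loc_coef_omega.
Qed.

(** If the class of [h] missed C(P), its class sum would lie in the Brauer kernel at [P], and so
    would all its multiples in the center of S[G]. Up to small coefficients e_B is such a multiple,
    against the hypothesis at [x]. *)
Lemma defect_min_max B i0 h P x : is_block M B -> i0 \in B -> h \in G ->
    omega i0 h \notin M -> p.-group P -> P \subset G -> x \in 'C_G(P) ->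
    ~ locJ M (a_block B x) ->
  exists2 y, y \in (h ^: G)%g & y \in 'C(P).
Proof.
move=> blB Bi0 Gh nMh pP sPG Cx nJx; apply/exists_inP.
case: (boolP [exists y in h ^: G, y \in 'C(P)]) => // noy.
have [w [Rw /(_ x) Jx]] := block_idem_approx blB Bi0 Gh nMh; case: nJx.
rewrite -(subrK (class_coef (fun i => omega i h * w i) x) (a_block B x)).
apply: (locJD maxM) => //; have [] // : brauer_ker P (fun i => omega i h * w i).
  apply: brauer_kerM => //; split; first exact: loc_coef_omega.
  move=> y /setIP[Gy Cy]; rewrite class_coef_omega //.
  case: (boolP (h \in _)) => [hy|]; last by move=> _; apply: (locJ_M maxM) => //; apply: (M0 maxM).
  by case/negP: noy; apply/exists_inP; exists y; rewrite // class_sym.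
move=> _; exact.
Qed.

(** The left side is the central character of ['chi_i] evaluated at e_B. *)
Lemma sum_a_block_omega B i : i \in B ->
  \sum_(x in G) a_block B x * ('chi_i x / 'chi_i 1%g) = 1.
Proof.
move=> Bi; have nzG : (#|G|%:R : algC) != 0 by rewrite pnatr_eq0 -lt0n cardG_gt0.
under eq_bigr do rewrite mulr_suml.
rewrite exchange_big (bigD1 i) //= [X in _ + X]big1 => [|j /andP[_ ji]].
  rewrite addr0 -[RHS](mulfV nzG).
  have:= first_orthogonality_relation i i; rewrite eqxx.
  move/(canRL (mulKf (invr_neq0 nzG))); rewrite invrK mulr1 => {2}<-.
  rewrite mulr_suml; apply: eq_bigr => x _.
  by field; rewrite nzG irr1_neq0.
have:= first_orthogonality_relation i j; rewrite eq_sym (negPf ji).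
move/eqP; rewrite mulf_eq0 invr_eq0 (negPf nzG) /= => /eqP S0.
transitivity ('chi_j 1%g / #|G|%:R / 'chi_i 1%g * (\sum_(x in G) 'chi_i x * 'chi_j x^-1%g)).
  rewrite mulr_sumr; apply: eq_bigr => x _; ring.
by rewrite S0 mulr0.
Qed.

(** Grouped by classes, the value of the central character at e_B is a sum equal to 1, so some term
    is a unit, and then both of its factors are. *)
Lemma defect_class_exists B : is_block M B ->
  exists2 x, x \in G & (forall i, i \in B -> omega i x \notin M) /\
    nonzero_mod M (a_block B x).
Proof.
move=> blB; have [i0 Bi0] := block_nonempty blB.
have Dsum : \sum_(xG in classes G) a_block B (repr xG) * omega i0 (repr xG) = 1.
  rewrite -[RHS](sum_a_block_omega Bi0) (set_partition_big _ (classes_partition G)).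
  apply: eq_bigr => _ /imsetP[x Gx ->]; set y := repr _.
  have xGy : y \in x ^: G by apply: mem_repr (class_refl _ _).
  have Dy : x ^: G = y ^: G by apply/class_eqP; rewrite class_sym.
  rewrite (eq_bigr (fun=> a_block B y * ('chi_i0 y / 'chi_i0 1%g))) => [|z].
    by rewrite sumr_const /omega Dy -mulr_natr; ring.
  by rewrite Dy => /imsetP[g Gg ->]; rewrite a_blockJ // cfunJ.
have Rx x : x \in G -> locR M (a_block B x * omega i0 x).
  by move=> Gx; apply: (locRM maxM); [apply: a_block_locR | apply: (locR_Aint maxM); apply: omega_Aint].
(* A boolean records whether the term lies in the maximal ideal, as read off from the numerator of a
   chosen fraction. *)
have: forall x, exists b : bool, x \in G ->
    if b then locJ M (a_block B x * omega i0 x)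
    else nonzero_mod M (a_block B x * omega i0 x).
  move=> x; have [Gx|] := boolP (x \in G); last by exists true.
  have [r [s [Ar As ns Dx]]] := Rx x Gx; exists (r \in M) => _.
  by case: ifP => Mr; exists r, s; rewrite ?Mr.
case/fin_all_exists=> b bP; have Grepr xG : xG \in classes G -> repr xG \in G.
  by case/imsetP=> x Gx ->; rewrite (subsetP (class_subG Gx (subxx G))) // (mem_repr x) ?class_refl.
have [all_b|] := boolP [forall (xG | xG \in classes G), b (repr xG)].
  case: (locJ1 maxM); rewrite -Dsum; apply: (locJ_sum maxM) => xG GxG.
  by have:= bP _ (Grepr _ GxG); rewrite (forall_inP all_b).
rewrite negb_forall_in => /exists_inP[xG GxG /negPf nb].
have:= bP _ (Grepr _ GxG); rewrite nb => /(nonzero_modP maxM)[_ nJ].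
set x := repr xG in nJ *; have Gx : x \in G := Grepr _ GxG.
exists x => //; split.
  move=> i Bi; have := Bi; move/(block_same _ blB Bi0) => /(_ x Gx) Mi.
  rewrite -(M_congr maxM Mi); apply/negP => Mi0; case: nJ.
  apply: (locJMl maxM); first exact: a_block_locR.
  exact: locJ_M maxM _ Mi0.
apply/(nonzero_modP maxM); split; first exact: a_block_locR.
move=> Ja; case: nJ; apply: (locJMr maxM) => //; apply: (locR_Aint maxM).
exact: omega_Aint.
Qed.

Lemma defect_group_exists B : is_block M B -> exists D, is_defect_group p M B D.
Proof.
case/defect_class_exists=> x Gx [nMx nzx].
by have [D sylD] := Sylow_exists p 'C_G[x]; exists D, x => //; rewrite inE.
Qed.

End BlockIdempotents.

(** * Vanishing of block idempotents at nontrivial p-elements *)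

Section VanishingOnPElements.

Variables (p : nat) (M : {pred algC}).
Hypotheses (p_pr : prime p) (maxM : max_ideal_over p M).

(** By induction z^p is congruent to 1; the binomial theorem makes (z - 1)^p congruent to z^p - 1
    modulo [p], and [M] is prime. *)
Lemma M_unity_root_p k z : z ^+ (p ^ k) = 1 -> z - 1 \in M.
Proof.
have Az m y : (m > 0)%N -> y ^+ m = 1 -> y \in Aint.
  by move=> m_gt0 ym1; apply: (@Aint_unity_root m) => //; apply/unity_rootP.
elim: k z => [|k IHk] z; first by rewrite expn0 expr1 => ->; rewrite subrr (M0 maxM).
move=> zk1; have Az1 : z \in Aint by apply: Az zk1; rewrite expn_gt0 prime_gt0.
have Mzp : z ^+ p - 1 \in M by apply: IHk; rewrite -exprM -expnS.
pose y := z - 1; have Ay : y \in Aint by rewrite rpredB ?Aint1.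
have My : y ^+ p \in M.
  have Dz : z = 1 + y by rewrite addrC subrK.
  suff Mmid : z ^+ p - 1 - y ^+ p \in M by rewrite -(M_congr maxM Mmid).
  have [q Dp] : exists q, p = q.+1 by exists p.-1; rewrite prednK ?prime_gt0.
  rewrite Dz exprDn Dp big_ord_recl big_ord_recr /= /bump /= add1n.
  rewrite bin0 binn expr0 !expr1n !mul1r !mulr1n; set S := \sum_(i < q) _.
  have -> : 1 + (S + y ^+ q.+1) - 1 - y ^+ q.+1 = S by ring.
  rewrite (M_sum maxM) // => i _; rewrite -mulr_natr (MMl maxM) //.
    by rewrite rpredM ?rpredX ?Aint1.
  rewrite (M_natr p_pr maxM) Dp prime_dvd_bin -?Dp //.
  by rewrite Dp /= add1n ltnS ltn_ord.
have: forall m, y ^+ m.+1 \in M -> y \in M.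
  elim=> [|m IHm]; first by rewrite expr1.
  by rewrite exprS => /(M_prime maxM Ay (rpredX _ Ay))/orP[//|/IHm].
by move/(_ p.-1); rewrite prednK ?prime_gt0 //; apply.
Qed.

(** In the Leibniz formula a permutation other than the identity picks an off-diagonal entry, and
    the diagonal product is congruent to 1. *)
Lemma locJ_det n (A : 'M[algC]_n) :
  (forall i j, locJ M (A i j - (i == j)%:R)) -> locJ M (\det A - 1).
Proof.
move=> JA; have RA i j : locR M (A i j).
  rewrite -(subrK (i == j)%:R (A i j)); apply: (locRD maxM); last exact: locR_nat maxM _.
  exact: (locJ_R maxM).
rewrite /determinant (bigD1 1%g) //= addrAC; apply: (locJD maxM).
  rewrite odd_perm1 expr0 mul1r.
  apply: (@proj2 (locR M (\prod_(i < n) A i ((1%g : {perm 'I_n}) i)))).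
  elim/big_ind: _ => [|x y [Rx Jx] [Ry Jy]|i _].
  - by split; [exact: locR_Aint maxM _ Aint1 | rewrite subrr; apply: locJ_M maxM _ (M0 maxM)].
  - split; first exact: (locRM maxM).
    have -> : x * y - 1 = x * (y - 1) + (x - 1) by ring.
    by apply: (locJD maxM) => //; apply: (locJMl maxM).
  by split=> //; rewrite perm1; have := JA i i; rewrite eqxx.
apply: (locJ_sum maxM) => s s1.
have [i si] : exists i, s i != i.
  apply/existsP; rewrite -negb_forall; apply: contra s1 => /forallP s1.
  by apply/eqP/permP=> i; rewrite perm1; apply/eqP.
apply: (locJMl maxM); first by apply: (locR_Aint maxM); rewrite rpredX ?rpredN ?Aint1.
rewrite (bigD1 i) //=; apply: (locJMr maxM).
  by elim/big_ind: _ => // [|x y]; [exact: locR_Aint maxM _ Aint1 | apply: (locRM maxM)].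
by have := JA i (s i); rewrite eq_sym (negPf si) subr0.
Qed.

(* Congruent idempotents are conjugate by E E' + (1 - E)(1 - E'). *)
Lemma tr_idem_congr n (E E' : 'M[algC]_n) :
  E *m E = E -> E' *m E' = E' -> (forall i j, locR M (E i j)) ->
  (forall i j, locJ M (E' i j - E i j)) -> \tr E = \tr E'.
Proof.
move=> EE E'E' RE JE; pose U := E *m E' + (1%:M - E) *m (1%:M - E').
have EU : E *m U = E *m E'.
  by rewrite mulmxDr !mulmxA EE [E *m (_ - _)]mulmxBr mulmx1 EE subrr mul0mx addr0.
have UE' : U *m E' = E *m E'.
  by rewrite mulmxDl -!mulmxA E'E' [(_ - _) *m E']mulmxBl mul1mx E'E' subrr mulmx0 addr0.
(* Since E' is congruent to E, this exhibits U as congruent to the identity, so its determinant is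
   nonzero. *)
have DU : U = 1%:M + (E + E - 1%:M) *m (E' - E).
  rewrite /U !(mulmxBl, mulmxBr, mulmxDl, mulNmx, mulmx1, mul1mx) EE.
  move: (E *m E') (1%:M : 'M_n) => X o; apply/matrixP=> i j; by rewrite !mxE; ring.
have uU : U \in unitmx.
  rewrite unitmxE unitfE; apply/eqP => U0; apply: (locJ1 maxM).
  rewrite -[1]opprK; apply: (locJN maxM); rewrite -[- 1]add0r -U0.
  apply: locJ_det => i j; rewrite DU !mxE addrAC subrr add0r.
  apply: (locJ_sum maxM) => k _; rewrite !mxE; apply: (locJMl maxM) => //.
  apply: (locRD maxM); first exact: (locRD maxM).
  by apply: (locR_Aint maxM); rewrite rpredN Aint_natr.
by rewrite -[E in LHS](mulmxK uU) EU -UE' mxtrace_mulC mulmxA mulVmx // mul1mx.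
Qed.

Variables (gT : finGroupType) (G : {group gT}).
Implicit Types (C N : {group gT}) (B : {set Iirr G}).

Lemma sum_rcoset_repr C (F : gT -> algC) : C \subset G ->
  \sum_(g in G) F g
    = \sum_(u in [set repr (C :* g) | g in G]) \sum_(c in C) F (c * u)%g.
Proof.
move=> sCG; rewrite (partition_big_imset (fun g => repr (C :* g))) /=.
apply: eq_bigr => _ /imsetP[g Gg ->]; set u := repr _.
have Cgu : u \in C :* g by rewrite mem_repr_rcoset.
have Du : C :* u = C :* g by apply: rcoset_eqP.
have Gu : u \in G.
  by case/rcosetP: Cgu => c Cc ->; rewrite groupM // (subsetP sCG).
rewrite [RHS](reindex_inj (mulIg u^-1%g)) /=; apply: eq_big => [i | i _].
  rewrite -mem_rcoset; apply/andP/idP => [[Gi /eqP Di]|Ci].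
    by rewrite -Di; apply/rcoset_eqP; rewrite (rcoset_eqP (mem_repr_rcoset C i)).
  split; first by case/rcosetP: Ci => c Cc ->; rewrite groupM // (subsetP sCG).
  by rewrite (rcoset_eqP Ci) Du.
by rewrite mulgKV.
Qed.

(* The m-isotypic part of e_B under left multiplication by C is the image of an
   idempotent matrix E m, and E m = E 0 mod M because C is a p-group. *)
Lemma a_block_sum_lin C B (m : Iirr C) : is_block M B -> C \subset G ->
  p.-group C -> abelian C ->
  \sum_(c in C) 'chi_m c * a_block B c = \sum_(c in C) a_block B c.
Proof.
move=> blB sCG pC abC; pose T := [set repr (C :* g) | g in G].
(* [E j] is the matrix of right multiplication by e_B on the ['chi_j]-isotypic part of the group
   algebra, in the basis indexed by the right coset representatives in [T]. *)
pose E (j : Iirr C) : 'M[algC]_#|T| := \matrix_(s, t)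
  \sum_(c in C) 'chi_j c * a_block B ((enum_val s)^-1 * c * enum_val t)%g.
have GT u : u \in T -> u \in G.
  case/imsetP=> g Gg ->; have:= mem_repr_rcoset C g.
  by case/rcosetP=> c Cc ->; rewrite groupM // (subsetP sCG).
have GTs (s : 'I_#|T|) : enum_val s \in G := GT _ (enum_valP s).
have linC j := char_abelianP C abC j.
have EE j : E j *m E j = E j.
  apply/matrixP=> s t; rewrite !mxE; set x := enum_val s; set y := enum_val t.
  have Gx : x \in G by apply: GT; apply: enum_valP.
  have Gy : y \in G by apply: GT; apply: enum_valP.
  under eq_bigr do rewrite !mxE.
  rewrite -(big_enum_val (fun u => (\sum_(c in C) 'chi_j c * a_block B (x^-1 * c * u)%g) *
     \sum_(c in C) 'chi_j c * a_block B (u^-1 * c * y)%g)) /=.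
  transitivity (\sum_(d in C) 'chi_j d * \sum_(g in G) a_block B (x^-1 * g)%g * a_block B (g^-1 * d * y)%g); last first.
    apply: eq_bigr => d Cd; congr (_ * _); have Gd := subsetP sCG d Cd.
    rewrite -[RHS]a_blockM; last by rewrite !groupM ?groupV.
    rewrite [RHS](reindex_inj (mulgI x^-1%g)) /=; apply: eq_big => [g|g Gg].
      by rewrite groupMl ?groupV.
    by rewrite invMg invgK !mulgA mulgK.
  under [RHS]eq_bigr => d Cd do rewrite (sum_rcoset_repr _ sCG) mulr_sumr.
  rewrite exchange_big /=; apply: eq_bigr => u Tu.
  rewrite big_distrlr /=; under [RHS]eq_bigr do rewrite mulr_sumr.
  rewrite [RHS]exchange_big /=; apply: eq_bigr => c Cc.
  rewrite [RHS](reindex_inj (mulgI c)) /=; apply: eq_big => [d | d Cd].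
    by rewrite groupMl.
  rewrite (lin_charM (linC j)) // invMg !mulgA mulgKV; ring.
have Ra c (s t : 'I_#|T|) : c \in C -> locR M (a_block B ((enum_val s)^-1 * c * enum_val t)%g).
  move=> Cc; apply: (a_block_locR p_pr maxM) => //.
  by rewrite !groupM ?groupV ?GTs ?(subsetP sCG c Cc).
have Mchi j c : c \in C -> 'chi[C]_j c - 1 \in M.
  move=> Cc; have [k Dk] := p_natP pC.
  apply: (@M_unity_root_p k); rewrite -Dk -(lin_charX (linC j)) //.
  by rewrite expg_cardG ?(lin_char1 (linC j)).
have JE : \tr (E m) = \tr (E 0).
  symmetry; apply: tr_idem_congr => // s t; rewrite !mxE.
    apply: (locR_sum maxM) => c Cc; apply: (locRM maxM); last exact: Ra.
    by apply: (locR_Aint maxM); apply: Aint_irr.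
  rewrite -sumrB; apply: (locJ_sum maxM) => c Cc; rewrite -mulrBl.
  apply: (locJMr maxM); first exact: Ra.
  by rewrite irr0 cfun1E Cc; apply: (locJ_M maxM); apply: Mchi.
(* As e_B is central, conjugation by a representative leaves its coefficients unchanged, and all
   diagonal entries coincide. *)
have trE j : \tr (E j) = #|T|%:R * \sum_(c in C) 'chi_j c * a_block B c.
  rewrite /mxtrace; transitivity (\sum_(s < #|T|) \sum_(c in C) 'chi_j c * a_block B c).
    apply: eq_bigr => s _; rewrite mxE; apply: eq_bigr => c Cc; congr (_ * _).
    by rewrite -mulgA -conjgE a_blockJ // GTs.
  by rewrite sumr_const card_ord mulr_natl.
move: JE; rewrite !trE => /mulfI ->.
  by apply: eq_bigr => c Cc; rewrite irr0 cfun1E Cc mul1r.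
rewrite pnatr_eq0 -lt0n card_gt0; apply/set0Pn; exists (repr (C :* 1)).
exact: imset_f.
Qed.

(** By [a_block_sum_lin] the Fourier transform of the coefficients of e_B on the cyclic group of [x]
    is constant, so they are supported at 1. *)
Lemma a_block_p_elt B x : is_block M B -> x \in G -> p.-elt x -> x != 1%g ->
  a_block B x = 0.
Proof.
move=> blB Gx px x1; pose C := <[x]>%G.
have sCG : C \subset G by rewrite cycle_subG.
have abC : abelian C := cycle_abelian x.
have Cx : x \in C := cycle_id x.
have linC j := char_abelianP C abC j.
have nzC : (#|C|%:R : algC) != 0 by rewrite pnatr_eq0 -lt0n cardG_gt0.
pose K := \sum_(c in C) a_block B c.
have D1 : \sum_(j : Iirr C) ('chi_j x)^* * (\sum_(c in C) 'chi_j c * a_block B c) = 0.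
  transitivity (K * \sum_(j : Iirr C) 'chi_j 1%g * ('chi_j x)^*).
    rewrite mulr_sumr; apply: eq_bigr => j _.
    by rewrite (a_block_sum_lin j blB) // (lin_char1 (linC j)) mul1r mulrC.
  by rewrite second_orthogonality_relation // class_sym class1G inE (negPf x1) mulr0.
have: #|C|%:R * a_block B x = 0.
  rewrite -{}D1; under eq_bigr do rewrite mulr_sumr.
  rewrite exchange_big (bigD1 x) //= [X in _ + X]big1 ?addr0 => [|c /andP[Cc cx]].
    under eq_bigr do rewrite mulrA [_^* * _]mulrC.
    rewrite -mulr_suml second_orthogonality_relation // class_refl mulr1n.
    by congr (_%:R * _); congr #|pred_of_set _|; apply/esym/setIidPl; rewrite sub_cent1 (subsetP abC).
  under eq_bigr do rewrite mulrA [_^* * _]mulrC.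
  rewrite -mulr_suml second_orthogonality_relation //.
  have -> : c \in x ^: C = false; last by rewrite mul0r.
  apply/negbTE; apply: contra cx => /imsetP[d Cd ->].
  by rewrite conjgE (centsP abC x Cx d Cd) mulKg.
by move/eqP; rewrite mulf_eq0 (negPf nzC) => /eqP.
Qed.

(** Pair ['chi_t] with the coefficients of e_B on [N]. Only the identity contributes, and
    positively; yet the pairing is a combination of the inner products of ['chi_t] with restrictions
    of characters of [B]. *)
Lemma block_over N B (t : Iirr N) : is_block M B -> N \subset G -> p.-group N ->
  exists2 i, i \in B & t \in irr_constt ('Res[N] 'chi_i).
Proof.
move=> blB sNG pN; have [i0 Bi0] := block_nonempty maxM blB.
have nzG : (#|G|%:R : algC) != 0 by rewrite pnatr_eq0 -lt0n cardG_gt0.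
have: \sum_(n in N) 'chi_t n * a_block B n != 0.
  rewrite (bigD1 1%g) //= big1 ?addr0 => [|n /andP[Nn n1]].
    rewrite mulf_neq0 ?irr1_neq0 // /a_block.
    apply: lt0r_neq0; have pos j : 0 < 'chi[G]_j 1%g * 'chi_j (1^-1)%g / #|G|%:R.
      by rewrite invg1 divr_gt0 ?mulr_gt0 ?irr1_gt0 // ltr0n cardG_gt0.
    by rewrite (bigD1 i0) //= ltr_pwDl ?pos // sumr_ge0 // => j _; apply/ltW/pos.
  by rewrite a_block_p_elt ?mulr0 ?(subsetP sNG) ?(mem_p_elt pN).
move=> nz; apply/exists_inP; apply: contraR nz.
rewrite negb_exists_in => /forall_inP noi; apply/eqP.
under eq_bigr do rewrite mulr_sumr.
rewrite exchange_big big1 //= => j Bj.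
have nzN : (#|N|%:R : algC) != 0 by rewrite pnatr_eq0 -lt0n cardG_gt0.
transitivity ('chi_j 1%g / #|G|%:R * #|N|%:R * '['chi_t, 'Res[N] 'chi_j]).
  rewrite cfdotE mulrA mulfK // mulr_sumr; apply: eq_bigr => n Nn.
  by rewrite cfResE // (char_inv _ (irr_char j)); ring.
have := noi j Bj; rewrite irr_consttE negbK cfdotC => /eqP t0.
by rewrite -['[_, _]]conjCK t0 conjC0 mulr0.
Qed.

End VanishingOnPElements.

(** * Normal p-subgroups, defect groups and heights *)

Lemma irr1_truncn (gT : finGroupType) (G : {group gT}) (i : Iirr G) :
  'chi_i 1%g = (Num.truncn ('chi_i 1%g))%:R.
Proof. by rewrite irr1_degree natrK. Qed.

Lemma truncn_irr1_gt0 (gT : finGroupType) (G : {group gT}) (i : Iirr G) :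
  (0 < Num.truncn ('chi_i 1%g))%N.
Proof. by rewrite irr1_degree natrK irr_degree_gt0. Qed.

Section NormalPSubgroups.

Variables (p : nat) (M : {pred algC}).
Hypotheses (p_pr : prime p) (maxM : max_ideal_over p M).

(** Cancelling the p-part of [n] leaves the left side outside [M]; on the right neither a remaining
    factor [p] nor an [a] in [M] is then possible. *)
Lemma notM_logn_eq (n m : nat) (w a : algC) : (n > 0)%N -> (m > 0)%N ->
  w \in Aint -> a \in Aint -> w \notin M -> n%:R * w = m%:R * a ->
  (logn p n <= logn p m)%N -> a \notin M /\ logn p n = logn p m.
Proof.
move=> n_gt0 m_gt0 Aw Aa nMw Dw le_nm.
have [n' con Dn] := pfactor_coprime p_pr n_gt0.
have [m' com Dm] := pfactor_coprime p_pr m_gt0.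
set e := logn p n in le_nm Dn *; set f := logn p m in le_nm Dm *.
have nzpe : ((p ^ e)%:R : algC) != 0 by rewrite pnatr_eq0 -lt0n expn_gt0 prime_gt0.
have nMn : n'%:R \notin M by rewrite (M_natr p_pr maxM) -prime_coprime.
have Dw' : n'%:R * w = (m' * p ^ (f - e))%:R * a.
  apply: (mulfI nzpe); rewrite !mulrA -!natrM mulnC -Dn Dw; congr (_%:R * _).
  by rewrite mulnCA -expnD subnKC.
have: (m' * p ^ (f - e))%:R * a \notin M by rewrite -Dw'; apply: notMM maxM _ _ _ _ _ _; rewrite ?Aint_natr.
move=> nMma; split; first by apply: contra nMma => Ma; rewrite (MMl maxM) ?Aint_natr.
apply/eqP; rewrite eqn_leq le_nm -subn_eq0; apply: contraR nMma => lt_ef.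
rewrite (MMr maxM) // (M_natr p_pr maxM) dvdn_mull //.
by case: (f - e)%N lt_ef => // k _; rewrite expnS dvdn_mulr.
Qed.

Lemma notM_logn_le (n m : nat) (w a : algC) : (n > 0)%N -> (m > 0)%N ->
  w \in Aint -> a \in Aint -> w \notin M -> n%:R * w = m%:R * a ->
  (logn p m <= logn p n)%N.
Proof.
move=> n_gt0 m_gt0 Aw Aa nMw Dw; rewrite leqNgt; apply/negP => lt_nm.
have [] := notM_logn_eq n_gt0 m_gt0 Aw Aa nMw Dw (ltnW lt_nm).
by move=> _ Dnm; rewrite Dnm ltnn in lt_nm.
Qed.

Variables (gT : finGroupType) (G : {group gT}).
Implicit Types (D N : {group gT}).

Lemma logn_index_Sylow x D : x \in G -> D \in 'Syl_p('C_G[x])%g ->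
  logn p #|G : D| = logn p #|x ^: G|.
Proof.
move=> Gx; rewrite inE => sylD; have [sDC pD p'D] := and3P sylD.
rewrite -index_cent1 -(Lagrange_index (subsetIl G 'C[x]) sDC).
rewrite lognM ?indexg_gt0 // [X in (_ + X)%N](_ : _ = 0%N) ?addn0 //.
by rewrite logn_coprime // prime_coprime // -p'natE.
Qed.

(** Heights are nonnegative: compare p-parts in chi(1) omega(x) = |class of x| chi(x). The truncated
    subtraction in [height] therefore loses nothing. *)
Lemma logn_defect_le_degree (i : Iirr G) x D : x \in G -> omega i x \notin M ->
  D \in 'Syl_p('C_G[x])%g ->
  (logn p #|G : D| <= logn p (Num.truncn ('chi_i 1%g)))%N.
Proof.
move=> Gx nMx sylD; rewrite (logn_index_Sylow Gx sylD).
apply: (@notM_logn_le _ _ (omega i x) ('chi_i x)); rewrite ?truncn_irr1_gt0 ?omega_Aint ?Aint_irr //.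
  by rewrite -index_cent1 indexg_gt0.
by rewrite -irr1_truncn /omega mulrC divfK ?irr1_neq0.
Qed.

(* Compute in a character of the block of i with N in its kernel. *)
Lemma omega_notM_cent N (i : Iirr G) x : N <| G -> p.-group N -> x \in G ->
  omega i x \notin M -> x \in 'C(N).
Proof.
move=> nsNG pN Gx nMx; have [sNG nNG] := andP nsNG.
have [j Bj] := block_over p_pr maxM (0 : Iirr N) (block_ofP M i) sNG pN.
move/(constt0_Res_cfker nsNG) => kerj.
have {nMx Bj} nMx : omega j x \notin M.
  by move: Bj; rewrite inE => /forall_inP/(_ x Gx) /(M_congr maxM) <-.
pose k := quo_Iirr N j; pose C := 'C_G[x].
pose L := (coset N @*^-1 'C_(G / N)[coset N x])%G.
have sLG : L \subset G by rewrite -(quotientGK nsNG) morphpreS ?subsetIl.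
have nNx := subsetP nNG x Gx.
have sCL : C \subset L.
  rewrite -sub_quotient_pre ?(subset_trans (subsetIl _ _)) //.
  by rewrite subsetI quotientS ?subsetIl // quotient_cent1s ?subsetIr.
have sNL : N \subset L by rewrite -{1}(ker_coset N) morphpreS ?sub1G.
have Dind : #|x ^: G| = (#|coset N x ^: (G / N)| * #|L : C|)%N.
  rewrite -!index_cent1 -(Lagrange_index sLG sCL); congr (_ * _)%N.
  by rewrite -{1}(quotientGK nsNG) index_cosetpre.
have Dw : omega j x = #|L : C|%:R * omega k (coset N x).
  rewrite /omega quo_IirrE // cfQuoE // cfQuo1 Dind natrM; ring.
(* The central character value at [x] is this index times an algebraic integer, so [p] cannot divide
   the index. *)
have p'LC : ~~ (p %| #|L : C|)%N.
  apply: contra nMx => pLC; rewrite Dw (MMr maxM) ?(M_natr p_pr maxM) //.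
  by rewrite omega_Aint ?mem_quotient.
suff sNC : N \subset C.
  by rewrite -sub1set centsC; apply: subset_trans sNC _; rewrite subIset // cent_set1 subxx orbT.
(* The index of the intersection with [C] in [N] is a power of [p] and divides [#|L : C|]. *)
rewrite -indexg_eq1 -dvdn1 -(eqnP (_ : coprime #|N : C| #|L : C|)).
  rewrite dvdn_gcd dvdnn -indexMg /=.
  have -> : (C * N = C <*> N)%g by rewrite norm_joinEl // (subset_trans (subsetIl _ _)).
  rewrite -(@Lagrange_index _ L (C <*> N)) ?dvdn_mull ?joing_subl //.
  by rewrite join_subG sCL.
have [e ->] := p_natP (pnat_dvd (dvdn_indexg N C) pN).
by rewrite coprimeXl ?prime_coprime.
Qed.

(** [N] centralizes [x], so it is a normal p-subgroup of the centralizer and lies in each of its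
    Sylow subgroups. *)
Lemma normal_pgroup_sub_defect N (i : Iirr G) x D : N <| G -> p.-group N ->
  x \in G -> omega i x \notin M -> D \in 'Syl_p('C_G[x])%g -> N \subset D.
Proof.
move=> nsNG pN Gx nMx; rewrite inE => sylD; have [sNG nNG] := andP nsNG.
have cNx := omega_notM_cent nsNG pN Gx nMx.
have sNC : N \subset 'C_G[x].
  by rewrite subsetI sNG -cent_set1 centsC sub1set.
apply: normal_sub_max_pgroup (Hall_max sylD) pN _.
by apply: normalS sNC (subsetIl _ _) nsNG.
Qed.

Lemma invariant_Res N (t : Iirr N) (i : Iirr G) : N <| G -> 'I_G['chi_t] = G ->
  t \in irr_constt ('Res[N] 'chi_i) ->
  'Res[N] 'chi_i = '['Res[N] 'chi_i, 'chi_t] *: 'chi_t.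
Proof.
move=> nsNG IG ti; rewrite {1}(Clifford_Res_sum_cfclass nsNG ti).
by rewrite cfclass_invariant ?big_seq1 // -{1}IG subsetIr.
Qed.

Lemma invariant_constt N (t s : Iirr N) (i : Iirr G) : N <| G -> 'I_G['chi_t] = G ->
  t \in irr_constt ('Res[N] 'chi_i) -> s \in irr_constt ('Res[N] 'chi_i) -> s = t.
Proof.
move=> nsNG IG ti; rewrite (invariant_Res nsNG IG ti) => /=.
rewrite irr_consttE cfdotZl cfdot_irr; case: (t =P s) => [->//|_].
by rewrite mulr0 eqxx.
Qed.

Lemma extends_to_defect N D (t : Iirr N) (i : Iirr G) x :
  N <| G -> p.-group N -> 'I_G['chi_t] = G -> t \in irr_constt ('Res[N] 'chi_i) ->
  x \in G -> omega i x \notin M -> D \in 'Syl_p('C_G[x])%g ->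
  height p D i = logn p (Num.truncn ('chi_t 1%g)) -> extends_to D 'chi_t.
Proof.
move=> nsNG pN IG ti Gx nMx sylD ht; have [sNG nNG] := andP nsNG.
have sND := normal_pgroup_sub_defect nsNG pN Gx nMx sylD.
have := sylD; rewrite inE => /and3P[/subsetIP[sDG cDx] pD _].
have [/existsP[k /eqP Dk]|noext] := boolP [exists k : Iirr D, 'Res[N] 'chi_k == 'chi_t].
  by exists 'chi_k; rewrite ?mem_irr.
(* A constituent of chi on [D] restricts to m theta on [N], with m a power of [p] because its degree
   divides |D|. As m = 1 would be an extension, [q] divides every such degree. *)
pose q : algC := (p * Num.truncn ('chi_t 1%g))%:R.
have degD k : k \in irr_constt ('Res[D] 'chi_i) -> exists2 b, b \in Aint & 'chi_k 1%g = q * b.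
  move=> ki; have /natrP[m Dm] : '['Res[N] 'chi_k, 'chi_t] \in Num.nat.
    by rewrite Cnat_cfdot_char ?cfRes_char ?irr_char.
  have Dk : 'Res[N] 'chi_k = m%:R *: 'chi_t.
    rewrite {1}['Res[N] _]cfun_sum_cfdot (bigD1 t) //= Dm big1 ?addr0 // => s st.
    suff /eqP -> : '['Res[N] 'chi_k, 'chi_s] == 0 by rewrite scale0r.
    apply: contraNT st => sk; apply/eqP/(invariant_constt nsNG IG ti).
    rewrite -(cfResRes _ sND sDG); apply: (constt_Res_trans _ ki sk).
    by rewrite cfRes_char ?irr_char.
  have Dk1 : 'chi_k 1%g = (m * Num.truncn ('chi_t 1%g))%:R.
    by rewrite -(cfRes1 N) Dk cfunE natrM -irr1_truncn.
  have [e De] := p_natP pD.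
  have: (m %| p ^ e)%N.
    rewrite -De; apply: dvdn_trans (dvdn_mulr (Num.truncn ('chi_t 1%g)) (dvdnn m)) _.
    by have := dvd_irr1_cardG k; rewrite Dk1 dvdC_nat.
  case/(dvdn_pfactor _ _ p_pr) => [[|f] _ Df].
    case/negP: noext; apply/existsP; exists k.
    by rewrite Dk Df expn0 scale1r.
  exists (p ^ f)%:R; rewrite ?Aint_natr // Dk1 Df expnS /q -natrM.
  by rewrite -mulnA [(p ^ f * _)%N]mulnC mulnA.
(* [x] is central in [Q], so each irreducible character of [Q] takes at [x] its degree times an
   algebraic integer; hence [q] divides chi(x). *)
pose Q := (D <*> <[x]>)%G.
have sDQ : D \subset Q := joing_subl _ _.
have Qx : x \in Q by rewrite (subsetP (joing_subr D <[x]>)) ?cycle_id.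
have sQG : Q \subset G by rewrite join_subG sDG cycle_subG.
have xQ : x ^: Q = [set x].
  apply/cent_classP; rewrite -sub1set centsC cent_set1 join_subG cDx cycle_subG.
  exact: cent1id.
have degQ k : k \in irr_constt ('Res[Q] 'chi_i) -> exists2 b, b \in Aint & 'chi_k 1%g = q * b.
  move=> ki; have sub j : j \in irr_constt ('Res[D] 'chi_k) -> exists2 b, b \in Aint & 'chi_j 1%g = q * b.
    move=> jk; apply: degD; rewrite -(cfResRes _ sDQ sQG).
    by apply: (constt_Res_trans _ ki jk); rewrite cfRes_char ?irr_char.
  rewrite -(cfRes1 D) ['Res[D] _]cfun_sum_constt sum_cfunE.
  elim/big_ind: _ => [|a b [a' Aa ->] [b' Ab ->]|j /sub[b Ab Db]].
  - by exists 0; rewrite ?mulr0.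
  - by exists (a' + b'); rewrite ?rpredD // mulrDr.
  rewrite cfunE Db mulrCA; eexists; last by [].
  by rewrite rpredM // Aint_Cnat // Cnat_cfdot_char ?cfRes_char ?irr_char.
have [a Aa Da] : exists2 a, a \in Aint & 'chi_i x = q * a.
  rewrite -(cfResE 'chi_i sQG Qx) ['Res[Q] _]cfun_sum_constt sum_cfunE.
  elim/big_ind: _ => [|a b [a' Aa ->] [b' Ab ->]|j /degQ[b Ab Db]].
  - by exists 0; rewrite ?mulr0.
  - by exists (a' + b'); rewrite ?rpredD // mulrDr.
  have Djx : 'chi_j x = 'chi_j 1%g * omega j x.
    by rewrite /omega xQ cards1 mul1r mulrC divfK ?irr1_neq0.
  rewrite cfunE Djx Db -mulrA mulrCA; eexists; last by [].
  apply: rpredM; last by apply: rpredM => //; apply: omega_Aint.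
  by rewrite Aint_Cnat // Cnat_cfdot_char ?cfRes_char ?irr_char.
have xG_gt0 : (0 < #|x ^: G|)%N by rewrite -index_cent1 indexg_gt0.
(* The height hypothesis equates the p-parts of chi(1) and |class of x| theta(1), which would force
   p a outside [M]. *)
have [] := @notM_logn_eq (Num.truncn ('chi_i 1%g)) (#|x ^: G| * Num.truncn ('chi_t 1%g)) (omega i x) (p%:R * a).
- exact: truncn_irr1_gt0.
- by rewrite muln_gt0 xG_gt0 truncn_irr1_gt0.
- exact: omega_Aint.
- by rewrite rpredM ?Aint_natr.
- by [].
- rewrite -irr1_truncn /omega mulrC divfK ?irr1_neq0 // Da /q !natrM; ring.
- rewrite lognM ?truncn_irr1_gt0 // -(logn_index_Sylow Gx sylD) -leq_subLR.
  by rewrite -ht leqnn.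
by case/negP; rewrite (MMr maxM) ?(Mp maxM).
Qed.

End NormalPSubgroups.

(** * A central extension in which an invariant character extends *)

(** Matrices over [algC] form an infinite type, so the finite group is built on the list itself and
    read through the injection [v]. *)
Lemma finGroup_of_seq (gT : finGroupType) (d : nat) (s : seq (gT * 'M[algC]_d)) :
    (1%g, 1%:M) \in s ->
    {in s &, forall y z, (y.1 * z.1, y.2 *m z.2)%g \in s} ->
    {in s, forall y, exists2 z, z \in s & (z.1 * y.1, z.2 *m y.2)%g = (1%g, 1%:M)} ->
  exists (hT : finGroupType) (v : hT -> gT * 'M[algC]_d),
    [/\ injective v, forall x, v x \in s, forall y, y \in s -> exists x, v x = y,
        v 1%g = (1%g, 1%:M)
      & forall x y, v (x * y)%g = ((v x).1 * (v y).1, (v x).2 *m (v y).2)%g].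
Proof.
move=> s1 sM sV.
have: forall x : seq_sub s, exists z : seq_sub s,
    ((val z).1 * (val x).1, (val z).2 *m (val x).2)%g = (1%g, 1%:M).
  by move=> x; have [z sz Dz] := sV _ (ssvalP x); exists (SeqSub sz).
case/fin_all_exists=> inv invP.
pose mul (x y : seq_sub s) : seq_sub s := SeqSub (sM _ _ (ssvalP x) (ssvalP y)).
pose one : seq_sub s := SeqSub s1.
have mulA : associative mul.
  by move=> x y z; apply: val_inj; rewrite /= mulgA mulmxA.
have mul1 : left_id one mul.
  by move=> x; apply: val_inj; rewrite /= mul1g mul1mx -surjective_pairing.
have mulV : left_inverse one inv mul by move=> x; apply: val_inj; apply: invP.
pose hT : finGroupType := HB.pack (seq_sub s) (Finite_isGroup.Build (seq_sub s) mulA mul1 mulV).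
exists hT, (val : seq_sub s -> _); split=> //; first exact: val_inj.
  by move=> x; apply: (ssvalP x).
by move=> y sy; exists (SeqSub sy).
Qed.

Section CharacterTripleExtension.

Variables (gT : finGroupType) (G N : {group gT}) (t : Iirr N).
Hypotheses (nsNG : N <| G) (IG : 'I_G['chi_t] = G).
Variables (d : nat) (Y : mx_representation algC N d).
Hypotheses (irrY : mx_irreducible Y) (DY : cfRepr Y = 'chi_t).

(* Bounding the order of det A keeps the group of pairs (g, A) finite while
   leaving room for the pairs (n, Y n), n in N. *)
Definition intertwines (y : gT * 'M[algC]_d) :=
  [/\ y.1 \in G, y.2 \in unitmx,
      forall n, n \in N -> Y n *m y.2 = y.2 *m Y (n ^ y.1)%g
    & (\det y.2) ^+ #|N| = 1].

Lemma intertwiner_scalar A : (forall n, n \in N -> Y n *m A = A *m Y n) ->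
  exists c, A = c%:M.
Proof.
move=> cA; apply/is_scalar_mxP.
apply: (mx_abs_irr_cent_scalar (rG := Y)); last by apply/centgmxP => n Nn; rewrite cA.
exact: groupC.
Qed.

(** By invariance [Y] and its conjugate by [g] afford the same character, hence are similar; a d-th
    root normalizes the determinant. *)
Lemma intertwiner_exists g : g \in G ->
  exists A : 'M[algC]_d, [/\ A \in unitmx, \det A = 1 &
    forall n, n \in N -> Y n *m A = A *m Y (n ^ g)%g].
Proof.
move=> Gg; have nNg : g \in 'N(N) by apply: subsetP Gg; apply: normal_norm.
have repYg : mx_repr N (fun n => Y (n ^ g)%g).
  split=> [|n m Nn Nm]; first by rewrite conj1g repr_mx1.
  by rewrite conjMg repr_mxM ?memJ_norm.
have: cfRepr Y = cfRepr (MxRepresentation repYg).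
  rewrite DY; apply/cfun_inP=> n Nn; rewrite [RHS]cfunE Nn mulr1n /=.
  rewrite -(inertia_valJ n (_ : g \in 'I['chi_t])); last by rewrite -IG in Gg; case/setIP: Gg.
  by rewrite -[in LHS]DY cfunE memJ_norm // Nn mulr1n.
case/cfRepr_inj => B _ freeB BP; have uB : B \in unitmx by rewrite -row_free_unit.
have d_gt0 : (0 < d)%N by case/mx_irrP: irrY.
have nzdB : \det B != 0 by rewrite -unitfE -unitmxE.
pose c := d.-root ((\det B)^-1).
have Dc : c ^+ d = (\det B)^-1 by rewrite rootCK.
have nzc : c != 0 by rewrite rootC_eq0 // invr_eq0.
exists (c *: B); split.
- by rewrite unitmxZ ?unitfE.
- by rewrite detZ Dc mulVf.
by move=> n Nn; rewrite -scalemxAr BP //= scalemxAl.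
Qed.

(** By Schur an intertwiner for [g] is a scalar times the chosen one of determinant 1, and the
    determinant bound makes that scalar a root of unity of order dividing d|N|. *)
Lemma intertwines_seq : exists s : seq (gT * 'M[algC]_d),
  forall y, y \in s <-> intertwines y.
Proof.
have: forall g, exists A : 'M[algC]_d, g \in G -> [/\ A \in unitmx, \det A = 1 &
    forall n, n \in N -> Y n *m A = A *m Y (n ^ g)%g].
  move=> g; have [/intertwiner_exists[A AP]|_] := boolP (g \in G); first by exists A.
  by exists 0.
case/fin_all_exists=> T TP.
have d_gt0 : (0 < d)%N by case/mx_irrP: irrY.
have m_gt0 : (0 < d * #|N|)%N by rewrite muln_gt0 d_gt0 cardG_gt0.
have [z zP] := C_prim_root_exists m_gt0.
have nzz : z != 0.
  apply: contraTneq (oner_neq0 algC) => z0; have := prim_expr_order zP.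
  by rewrite z0 expr0n eqn0Ngt m_gt0 => <-; rewrite eqxx.
exists [seq (g, z ^+ i *: T g) | g <- enum G, i <- iota 0 (d * #|N|)] => y.
split=> [/allpairsP[[g i] /= [+ _ ->]]|[Gg uA AP detA]].
  rewrite mem_enum => Gg; have [uT detT TPn] := TP g Gg.
  split=> //=.
  - by rewrite unitmxZ // unitfE expf_neq0.
  - by move=> n Nn; rewrite -scalemxAr TPn // scalemxAl.
  by rewrite detZ detT mulr1 -!exprM mulnC exprM (prim_expr_order zP) expr1n.
apply/allpairsP; case: y Gg uA AP detA => g A /= Gg uA AP detA; have [uT detT TPn] := TP g Gg.
have [c Dc] : exists c, A *m invmx (T g) = c%:M.
  apply: intertwiner_scalar => n Nn; rewrite mulmxA AP // -!mulmxA; congr (_ *m _).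
  by rewrite -[LHS](mulKmx uT) [T g *m _]mulmxA -TPn // mulmxK.
have DA : A = c *: T g by rewrite -mul_scalar_mx -Dc mulmxKV.
have [] := prim_rootP zP (_ : c ^+ (d * #|N|) = 1).
  by rewrite exprM; move: detA; rewrite DA detZ detT mulr1.
move=> i Di; exists (g, nat_of_ord i).
by split; rewrite /= ?mem_enum ?mem_iota ?add0n ?ltn_ord // DA Di.
Qed.

Lemma char_triple_extension p : p.-group N ->
  exists (hT : finGroupType) (H K : {group hT}) (f : {morphism H >-> gT}) (e : Iirr H),
   [/\ f @* H = G, 'ker f \subset 'Z(H), p.-group ('ker f) & K <| H]%g /\
   [/\ K :&: 'ker f = 1, f @* K = N, forall x, x \in K -> 'chi_e x = 'chi_t (f x),
       'Res[K] 'chi_e \in irr K & 'ker f :&: cfker 'chi_e = 1]%g.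
Proof.
move=> pN; have [s sP] := intertwines_seq.
have nNG := normal_norm nsNG; have sNG := normal_sub nsNG.
have [//|||hT [v [inj_v sv onto_v v1 vM]]] := @finGroup_of_seq _ _ s.
- apply/sP; split; rewrite /= ?group1 ?unitmx1 ?det1 ?expr1n // => n Nn.
  by rewrite conjg1 mulmx1 mul1mx.
- move=> y z /sP[Gy uy yP dy] /sP[Gz uz zP dz]; apply/sP; split=> /=.
  + by rewrite groupM.
  + by rewrite unitmx_mul uy.
  + move=> n Nn; rewrite mulmxA yP // -[LHS]mulmxA zP ?memJ_norm ?(subsetP nNG) //.
    by rewrite mulmxA conjgM.
  by rewrite det_mulmx exprMn dy dz mulr1.
- move=> y /sP[Gy uy yP dy]; exists (y.1^-1%g, invmx y.2); last by rewrite /= mulVg mulVmx.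
  apply/sP; split=> /=; rewrite ?groupV ?unitmx_inv //.
    move=> n Nn; have Nny : (n ^ y.1^-1)%g \in N by rewrite memJ_norm ?groupV ?(subsetP nNG).
    by rewrite -[LHS](mulKmx uy) [y.2 *m _]mulmxA -{1}(conjgKV y.1 n) -yP // mulmxK.
  by rewrite det_inv exprVn dy invr1.
have vP x : intertwines (v x) by apply/sP/sv.
have fM : {in [set: hT] &, {morph (fun x => (v x).1) : x y / (x * y)%g}}.
  by move=> x y _ _ /=; rewrite vM.
pose f := Morphism fM; pose H := [set: hT]%G.
have kerP x : x \in 'ker f -> exists c, v x = (1%g, c%:M).
  move/mker => /= vx1; have [_ _ cA _] := vP x.
  have [n Nn|c Dc] := @intertwiner_scalar (v x).2; last first.
    by exists c; rewrite -Dc -vx1 -surjective_pairing.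
  by rewrite cA // vx1 conjg1.
have repX : mx_repr H (fun x => (v x).2).
  by split=> [|x y _ _]; rewrite ?v1 ?vM.
pose X := MxRepresentation repX.
(* The pairs (n, Y n) lift [N]; on them the second projection is [Y], so its character extends
   theta. *)
pose K0 := [set x | ((v x).1 \in N) && ((v x).2 == Y (v x).1)].
have gK : group_set K0.
  apply/group_setP; split; first by rewrite inE v1 /= group1 repr_mx1 eqxx.
  move=> x y /setIdP[Nx /eqP Dx] /setIdP[Ny /eqP Dy].
  by rewrite inE vM /= groupM // Dx Dy repr_mxM ?eqxx.
pose K := Group gK.
have KP x : x \in K -> (v x).1 \in N /\ (v x).2 = Y (v x).1 by case/setIdP => Nx /eqP.
have vV x : v x^-1%g = ((v x).1^-1%g, invmx (v x).2).
  have [_ ux _ _] := vP x; have := vM x^-1%g x; rewrite mulVg v1 => -[D1 D2].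
  rewrite [LHS]surjective_pairing; congr (_, _).
    by apply: (mulIg (v x).1); rewrite mulVg.
  by rewrite -[LHS](mulmxK ux) -D2 mul1mx.
have fK : f @* K = N.
  apply/eqP; rewrite eqEsubset; apply/andP; split.
    by apply/subsetP=> _ /morphimP[x _ Kx ->]; case: (KP x Kx).
  apply/subsetP=> n Nn; have [|x Dx] := onto_v (n, Y n).
    apply/sP; split=> /=; rewrite ?(subsetP sNG) //.
    - by apply: repr_mx_unit.
    - by move=> m Nm; rewrite -!repr_mxM ?groupJ // -conjgC.
    (* The pair (n, Y n) meets the determinant bound because det Y is multiplicative and n^|N| =
       1. *)
    have Ydet k : \det (Y n) ^+ k = \det (Y (n ^+ k)%g).
      elim: k => [|k IHk]; first by rewrite expr0 expg0 repr_mx1 det1.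
      by rewrite exprS expgS repr_mxM ?groupX // det_mulmx IHk.
    by rewrite Ydet expg_cardG // repr_mx1 det1.
  by apply/morphimP; exists x; rewrite /= ?inE ?Dx /= ?Nn ?eqxx.
have KkerI : K :&: 'ker f = 1%g.
  apply/trivgP/subsetP=> x /setIP[/KP[_ Dx2] /mker /= Dx1]; rewrite inE.
  by apply/eqP/inj_v; rewrite v1 [LHS]surjective_pairing Dx2 Dx1 repr_mx1.
have injK : {in K &, injective f}.
  move=> x y /KP[_ Dx] /KP[_ Dy] /= Dxy; apply: inj_v.
  by rewrite [LHS]surjective_pairing [RHS]surjective_pairing Dx Dy Dxy.
have XK x : x \in K -> cfRepr X x = 'chi_t (f x).
  by move=> Kx; have [Nx Dx] := KP x Kx; rewrite -DY !cfunE inE Nx /= Dx.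
(* [f] is a bijection from [K] to [N], so the restriction has the same norm as theta. *)
have irrXK : 'Res[K] (cfRepr X) \in irr K.
  rewrite irrEchar cfRes_char ?cfRepr_char //=.
  rewrite -[X in _ == X](cfnorm_irr t) !cfdotE; apply/eqP; congr (_ * _).
    by congr (_%:R^-1); rewrite -fK morphimEsub ?subsetT // card_in_imset.
  have DN : f @: K = N by rewrite -morphimEsub ?subsetT.
  rewrite [RHS](eq_bigl (mem (f @: K))) => [|x]; last by rewrite DN.
  rewrite big_imset //=.
  by apply: eq_bigr => x Kx; rewrite cfResE ?subsetT // XK.
have irrX : cfRepr X \in irr H.
  by apply: cfRes_irr_irr irrXK; exact: cfRepr_char.
have [e De] : exists e, 'chi_e = cfRepr X by case/irrP: irrX => e ->; exists e.
have d_gt0 : (0 < d)%N by case/mx_irrP: irrY.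
exists hT, H, K, f, e; split; split.
- apply/eqP; rewrite eqEsubset; apply/andP; split.
    by apply/subsetP=> _ /morphimP[x _ _ ->]; case: (vP x).
  apply/subsetP=> g Gg; have [A [uA dA AP]] := intertwiner_exists Gg.
  have [|x Dx] := onto_v (g, A); first by apply/sP; split; rewrite /= ?dA ?expr1n.
  by apply/morphimP; exists x; rewrite /= ?inE ?Dx.
- apply/subsetP=> x /kerP[c Dx]; rewrite inE inE; apply/centP=> y _.
  apply: inj_v; rewrite !vM Dx /= mul1g mulg1; congr (_, _).
  by rewrite scalar_mxC.
(* A kernel element is a scalar whose (d|N|)-th power is 1, and d = theta(1) divides |N|, a power of
   [p]. *)
- have p_m : p.-nat (d * #|N|).
    rewrite pnatM (pnat_dvd _ pN) //.
    by have := dvd_irr1_cardG t; rewrite -DY cfRepr1 dvdC_nat.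
  apply/pgroupP=> q q_pr /(Cauchy q_pr)[x /kerP[c Dx] Dq].
  apply: (pnatPpi p_m); rewrite mem_primes q_pr muln_gt0 d_gt0 cardG_gt0 /= -Dq.
  rewrite order_dvdn; apply/eqP/inj_v; rewrite v1.
  have vX k : v (x ^+ k)%g = (1%g, (c ^+ k)%:M).
    elim: k => [|k IHk]; first by rewrite expg0 v1 expr0.
    by rewrite expgS vM IHk Dx /= mulg1 -scalar_mxM exprS.
  by rewrite vX; have [_ _ _] := vP x; rewrite Dx /= det_scalar -exprM => ->.
- apply/andP; split; first exact: subsetT.
  apply/subsetP=> y _; rewrite inE; apply/subsetP=> _ /imsetP[x /KP[Nx Dx] ->].
  have [Gy uy yP _] := vP y; rewrite inE conjgE !vM vV /= -conjgE memJ_norm ?(subsetP nNG) // Nx /=.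
  by rewrite Dx yP // mulKmx.
- exact: KkerI.
- exact: fK.
- by move=> x Kx; rewrite De XK.
- by rewrite De.
apply/trivgP/subsetP=> x /setIP[/kerP[c Dx]] => kx.
have {kx} : x \in cfker 'chi_e by [].
rewrite cfkerEirr !inE De !cfunE !inE /= v1 Dx /=.
rewrite !mulr1n mxtrace_scalar mxtrace1 -[X in X == _]mulr_natr -[X in _ == X]mul1r => /eqP.
have nzd : (d%:R : algC) != 0 by rewrite pnatr_eq0 -lt0n.
by move/(mulIf nzd) => c1; apply/eqP/inj_v; rewrite v1 Dx c1.
Qed.

End CharacterTripleExtension.

(** * Gallagher correspondence, comparison of blocks and the abelian quotient *)

Lemma irr_of_morphim (hT gT : finGroupType) (H : {group hT})
    (f : {morphism H >-> gT}) (j : Iirr H) : 'ker f \subset cfker 'chi_j ->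
  exists i : Iirr (f @* H), forall x, x \in H -> 'chi_i (f x) = 'chi_j x.
Proof.
move=> kerj; have nsKH : 'ker f <| H := ker_normal f.
have sKq : 'ker (coset ('ker f)) \subset 'ker f by rewrite ker_coset.
pose ff := factm_morphism sKq (normal_norm nsKH).
have iso : isom (H / 'ker f) (f @* H) ff.
  apply/isomP; split; first by apply/injm_factmP; rewrite ker_coset.
  by rewrite /= -[RHS](morphim_factm sKq (normal_norm nsKH)).
exists (isom_Iirr iso (quo_Iirr ('ker f) j)) => x Hx.
rewrite isom_IirrE -(factmE sKq (normal_norm nsKH) Hx) -[factm _ _]/(ff : _ -> _).
by rewrite cfIsomE ?mem_quotient // quo_IirrE // cfQuoE.
Qed.

Section Correspondence.

Variables (hT gT : finGroupType) (H K : {group hT}) (f : {morphism H >-> gT}).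
Variables (t : Iirr (f @* K)) (e : Iirr H).
Hypotheses (kZ : 'ker f \subset 'Z(H)) (nsKH : K <| H).
Hypotheses (KI : (K :&: 'ker f = 1)%g) (eK : forall x, x \in K -> 'chi_e x = 'chi_t (f x)).
Hypotheses (irrK : 'Res[K] 'chi_e \in irr K) (ekI : ('ker f :&: cfker 'chi_e = 1)%g).

Let G := (f @* H)%G.
Let N := (f @* K)%G.
Let sKH : K \subset H := normal_sub nsKH.
Let nKH : H \subset 'N(K) := normal_norm nsKH.

Definition triple_corr (i : Iirr G) (b : Iirr (H / K)) :=
  forall x, x \in H -> 'chi_i (f x) = 'chi_e x * 'chi_b (coset K x).

Lemma morphim_K_normal : N <| G. Proof. exact: morphim_normal. Qed.

Lemma triple_degree : 'chi_e 1%g = 'chi_t 1%g.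
Proof. by rewrite eK ?group1 // morph1. Qed.

Lemma triple_corr_degree i b : triple_corr i b -> 'chi_i 1%g = 'chi_t 1%g * 'chi_b 1%g.
Proof. by move=> cib; have := cib 1%g (group1 H); rewrite !morph1 triple_degree. Qed.

(** The inflation of ['chi_i] to [H] lies over the restriction of ['chi_e] to [K], and Gallagher
    factors it. *)
Lemma triple_corr_exists i : 'I_G['chi_t] = G -> t \in irr_constt ('Res[N] 'chi_i) ->
  exists b, triple_corr i b.
Proof.
move=> IG ti; have [t1 Dt1] := irrP irrK.
have [_ _ Gal _] := constt_Ind_ext nsKH Dt1.
have sHH := subxx H; pose j := morph_Iirr i.
have jE x : x \in H -> 'chi_j x = 'chi_i (f x).
  by move=> Hx; rewrite morph_IirrE // cfMorphE.
have: j \in irr_constt ('Ind[H] 'chi_t1).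
  rewrite constt_Ind_Res irr_consttE.
  have -> : 'Res[K] 'chi_j = '['Res[N] 'chi_i, 'chi_t] *: 'chi_t1.
    apply/cfun_inP=> x Kx; have Hx := subsetP sKH x Kx.
    rewrite cfResE // jE // -Dt1 cfunE cfResE // eK //.
    have Nfx : f x \in N by apply: mem_morphim.
    have /(congr1 (fun phi : 'CF(N) => phi (f x))) := invariant_Res morphim_K_normal IG ti.
    by rewrite /= cfResE ?(normal_sub morphim_K_normal) // cfunE.
  by rewrite cfdotZl cfnorm_irr mulr1 -irr_consttE.
rewrite Gal => /codomP[b Db]; exists b => x Hx; rewrite -jE // Db.
have [irrM _ _ _] := constt_Ind_ext nsKH Dt1.
by rewrite /mul_mod_Iirr cfIirrE // cfunE mod_IirrE // cfModE // mulrC.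
Qed.

(** The Gallagher product is irreducible; by hypothesis ['ker f] lies in its kernel, so it descends
    to [G]. *)
Lemma triple_corr_irr (b : Iirr (H / K)) :
    (forall z, z \in 'ker f -> 'chi_e z * 'chi_b (coset K z) = 'chi_e 1%g * 'chi_b 1%g) ->
  exists2 i, triple_corr i b & t \in irr_constt ('Res[N] 'chi_i).
Proof.
move=> kerb; have [t1 Dt1] := irrP irrK.
have [irrM _ _ _] := constt_Ind_ext nsKH Dt1; have [j Dj] := irrP (irrM b).
have jE x : x \in H -> 'chi_j x = 'chi_e x * 'chi_b (coset K x).
  by move=> Hx; rewrite -Dj cfunE mod_IirrE // cfModE // mulrC.
have kerj : 'ker f \subset cfker 'chi_j.
  apply/subsetP=> z kz; have Hz := subsetP (normal_sub (ker_normal f)) z kz.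
  by rewrite cfkerEirr inE !jE ?group1 // morph1 kerb.
have [i iE] := irr_of_morphim kerj.
have cib : triple_corr i b by move=> x Hx; rewrite iE // jE.
exists i => //; rewrite irr_consttE.
have -> : 'Res[N] 'chi_i = 'chi_b 1%g *: 'chi_t.
  apply/cfun_inP=> _ /morphimP[x Hx Kx ->]; rewrite cfResE ?mem_morphim ?(normal_sub morphim_K_normal) //.
  by rewrite cib // cfunE eK // coset_id // mulrC.
by rewrite cfdotZl cfnorm_irr mulr1 irr1_neq0.
Qed.

(** Commutators of [x] with [K] lie in both [K] and ['ker f], so [x] centralizes [K]. It is then
    central in K<x>, where ['chi_e] remains irreducible. *)
Lemma cent_cfcenter x : x \in H -> f x \in 'C(N) -> x \in 'Z('chi_e)%CF.
Proof.
move=> Hx cfx; rewrite irr_cfcenterE //.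
have cKx : x \in 'C(K).
  apply/centP=> k Kk; have Hk := subsetP sKH k Kk; apply/commgP.
  have D1 : [set 1%g] = K :&: 'ker f by rewrite KI.
  rewrite -in_set1 D1 inE; apply/andP; split.
    by rewrite commgEr groupM // memJ_norm ?groupV // (subsetP nKH).
  apply/kerP; rewrite ?groupR // morphR //; apply/eqP/commgP.
  by apply: (centP cfx); rewrite mem_morphim.
pose Q := (K <*> <[x]>)%G.
have sKQ : K \subset Q := joing_subl _ _.
have Qx : x \in Q by rewrite (subsetP (joing_subr K <[x]>)) ?cycle_id.
have sQH : Q \subset H by rewrite join_subG sKH cycle_subG.
have ZQx : x \in 'Z(Q).
  have sKC : K \subset 'C[x] by rewrite -cent_set1 centsC sub1set.
  rewrite inE Qx -sub1set centsC cent_set1 join_subG sKC cycle_subG.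
  exact: cent1id.
have irrQ : 'Res[Q] 'chi_e \in irr Q.
  by apply: (@cfRes_irr_irr _ Q K); rewrite ?cfRes_char ?irr_char // cfResRes.
have [q Dq] := irrP irrQ; move: ZQx; rewrite -cap_cfcenter_irr => /bigcapP/(_ q isT).
by rewrite irr_cfcenterE // -Dq cfResE ?cfRes1.
Qed.

Lemma cfcenter_value_Aint x : x \in 'Z('chi_e)%CF -> 'chi_e x / 'chi_e 1%g \in Aint.
Proof.
move=> Zx; have [xi Lxi Dxi] := cfcenter_Res 'chi_e.
have := cfResE 'chi_e (cfcenter_sub 'chi_e) Zx; rewrite Dxi cfunE => <-.
by rewrite mulrAC divff ?irr1_neq0 // mul1r Aint_char // lin_charW.
Qed.

Definition cent_mod_K x := (coset K @*^-1 'C_(H / K)[coset K x])%G.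
Definition cent_mod_ker x := (f @*^-1 'C_G[f x])%G.

(** If [x, y] lies in ['ker f], it also lies in the kernel of ['chi_e], since [x] is central modulo
    that kernel. So [x] and [y] commute. *)
Lemma cent_mod_ker_sub x : x \in H -> f x \in 'C(N) -> cent_mod_ker x \subset cent_mod_K x.
Proof.
move=> Hx cfx; have Zx := cent_cfcenter Hx cfx.
apply/subsetP=> y /morphpreP[Hy /setIP[_ cxy]].
suff cxy1 : [~ x, y] = 1%g.
  have nKx := subsetP nKH x Hx; have nKy := subsetP nKH y Hy.
  apply/morphpreP; split=> //; rewrite inE mem_quotient //=.
  apply/cent1P; apply/commgP; rewrite -morphR //.
  by rewrite -[[~ y, x]]invgK invg_comm cxy1 invg1 morph1.
have D1 : [set 1%g] = 'ker f :&: cfker 'chi_e by rewrite ekI.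
apply/set1P; rewrite D1 inE; apply/andP; split.
  apply/kerP; rewrite ?groupR // morphR //; apply/eqP/commgP.
  by apply/cent1P; rewrite cent1C.
have nkx : x \in 'N(cfker 'chi_e) by rewrite (subsetP (normal_norm (cfker_normal _))).
have nky : y \in 'N(cfker 'chi_e) by rewrite (subsetP (normal_norm (cfker_normal _))).
have: coset (cfker 'chi_e) x \in 'Z(H / cfker 'chi_e)%g.
  by rewrite -cfcenter_eq_center mem_quotient.
case/setIP=> _ /centP/(_ (coset _ y)) => cc; apply: coset_idr; first by rewrite groupR.
by rewrite morphR //; apply/eqP/commgP; apply: cc; rewrite mem_quotient.
Qed.

Lemma card_class_morphim x : x \in H -> #|f x ^: G| = #|H : cent_mod_ker x|.
Proof.
move=> Hx; rewrite -index_cent1 -(index_morphpre _ (subxx (f @* H))).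
by rewrite morphimGK ?subxx // normal_sub ?ker_normal.
Qed.

Lemma card_class_quotient x : x \in H -> #|coset K x ^: (H / K)| = #|H : cent_mod_K x|.
Proof.
by move=> Hx; rewrite -index_cent1 -[in LHS]index_cosetpre quotientGK.
Qed.

Lemma cent_mod_K_sub x : cent_mod_K x \subset H.
Proof. by rewrite -(quotientGK nsKH) morphpreS ?subsetIl. Qed.

Lemma triple_corr_omega i b x : triple_corr i b -> x \in H -> f x \in 'C(N) ->
  omega i (f x) = 'chi_e x / 'chi_e 1%g * #|cent_mod_K x : cent_mod_ker x|%:R * omega b (coset K x).
Proof.
move=> cib Hx cfx; rewrite /omega card_class_morphim // card_class_quotient //.
rewrite -(Lagrange_index (cent_mod_K_sub x) (cent_mod_ker_sub Hx cfx)) natrM cib // (triple_corr_degree cib) triple_degree.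
by field; rewrite !irr1_neq0.
Qed.

Variables (p : nat) (M : {pred algC}).
Hypotheses (p_pr : prime p) (maxM : max_ideal_over p M) (pN : p.-group N).

(** On C(N) the two central characters of [G] carry the same integral factor; off C(N) both vanish
    modulo [M]. *)
Lemma triple_corr_same_block i b i' b' : triple_corr i b -> triple_corr i' b' ->
  same_block M b b' -> same_block M i i'.
Proof.
move=> cib cib' bb' _ /morphimP[x Hx _ ->].
have Gfx : f x \in G by rewrite mem_morphim.
have [cfx|ncfx] := boolP (f x \in 'C(N)).
  rewrite (triple_corr_omega cib) // (triple_corr_omega cib') // -mulrBr (MMl maxM) //; last by apply: bb'; rewrite mem_quotient.
  by rewrite rpredM ?Aint_natr // cfcenter_value_Aint // cent_cfcenter.
have Mo (j : Iirr G) : omega j (f x) \in M.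
  by apply: contraR ncfx; apply: (omega_notM_cent p_pr maxM morphim_K_normal).
by have := MB maxM (Mo i) (Mo i').
Qed.

Hypothesis (pk : p.-group ('ker f)).

Lemma triple_corr_defect_abelian (B : {set Iirr G}) (D : {group gT}) :
  ConjectureA -> 'I_G['chi_t] = G -> is_block M B -> is_defect_group p M B D ->
  (forall i, i \in irr_block_over B t ->
     height p D i = logn p (Num.truncn ('chi_t 1%g))) ->
  abelian (D / N).
Proof.
move=> conjA IG blB [_ /morphimP[x Hx _ ->] [nMB _ sylD]] ht.
have sNG := normal_sub morphim_K_normal; have Gfx : f x \in G by rewrite mem_morphim.
have [i0 Bi0 ti0] := block_over p_pr maxM t blB sNG pN.
have nMx := nMB i0 Bi0.
have cfx := omega_notM_cent p_pr maxM morphim_K_normal pN Gfx nMx.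
have sND := normal_pgroup_sub_defect p_pr maxM morphim_K_normal pN Gfx nMx sylD.
have [b0 cb0] := triple_corr_exists IG ti0.
pose xb := coset K x; have HKx : xb \in (H / K)%g by rewrite mem_quotient.
have Au : 'chi_e x / 'chi_e 1%g \in Aint by rewrite cfcenter_value_Aint // cent_cfcenter.
have Ab0 : omega b0 xb \in Aint := omega_Aint b0 HKx.
move: nMx; rewrite (triple_corr_omega cb0 Hx cfx) -/xb => nMx.
(* The product formula has all its factors integral, so none of them lies in [M]. *)
have nMb0 : omega b0 xb \notin M.
  by apply: contra nMx => Mb; rewrite (MMl maxM) // rpredM ?Aint_natr.
have p'r : ~~ (p %| #|cent_mod_K x : cent_mod_ker x|)%N.
  apply: contra nMx; rewrite -(M_natr p_pr maxM) => Mr.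
  by rewrite (MMr maxM) // (MMl maxM).
pose Z := ('ker f / K)%G; pose L := (f @*^-1 D)%G.
have := sylD; rewrite inE => /and3P[/subsetIP[sDG cDx] pD p'D].
have sLH : L \subset H by apply: subsetIl.
have sKL : K \subset L by rewrite -sub_morphim_pre.
have nsKL : K <| L by apply: normalS nsKH.
have sL_ker : L \subset cent_mod_ker x by rewrite morphpreS // subsetI sDG.
(* The index of [L] in the preimage of the centralizer is the p'-index above times that of [D] in
   the centralizer of f(x). *)
have sylL : p.-Sylow('C_(H / K)[xb]) (L / K)%g.
  have DC : 'C_(H / K)[xb] = (cent_mod_K x / K)%g by rewrite cosetpreK.
  have sL_K := subset_trans sL_ker (cent_mod_ker_sub Hx cfx).
  rewrite /pHall DC quotientS //=.
  rewrite quotient_pgroup /=; last first.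
    by rewrite /pgroup card_morphpre // pnatM; apply/andP; split; [exact: pk | exact: pD].
  have sK_int : cent_mod_K x :&: K \subset L by rewrite subIset // sKL orbT.
  rewrite (index_quotient_eq sK_int sL_K (subset_trans (cent_mod_K_sub x) nKH)).
  rewrite -(Lagrange_index (cent_mod_ker_sub Hx cfx) sL_ker) pnatM p'natE // p'r /=.
  by rewrite index_morphpre ?subsetIl.
have indL : #|H / K : L / K| = #|G : D|.
  have sHK : H :&: K \subset L by rewrite subIset // sKL orbT.
  rewrite (index_quotient_eq sHK sLH nKH).
  by rewrite -(index_morphpre _ (subxx (f @* H))) morphimGK ?subxx // normal_sub ?ker_normal.
pose B0 := block_of M b0; have blB0 : is_block M B0 := block_ofP M b0.
have B0b0 : b0 \in B0 := mem_block_of maxM b0.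
have [P defP] := defect_group_exists p_pr maxM blB0.
have [h Hh [nMh nzh sylP]] := defP.
have := sylP; rewrite inE => /and3P[/subsetIP[sPH cPh] pP _].
have hCP : h \in 'C_(H / K)(P).
  by rewrite inE Hh -sub1set centsC cent_set1.
have [_ nJh] := (nonzero_modP maxM _).1 nzh.
(* By min-max some conjugate of [xb] centralizes [P], which places [P] in a conjugate of the Sylow
   subgroup L/K. *)
have [y /imsetP[a Ha ->] cPy] := defect_min_max p_pr maxM blB0 B0b0 HKx nMb0 pP sPH hCP nJh.
have [c Cc sPL] : exists2 c, c \in (H / K)%g & P \subset (L / K) :^ c.
  have sPC : P :^ a^-1 \subset 'C_(H / K)[xb].
    rewrite sub_conjgV conjIg conjGid // -cent1J subsetI sPH /=.
    by rewrite -cent_set1 centsC sub1set.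
  have pPa : p.-group (P :^ a^-1)%G by rewrite pgroupJ.
  have [c /setIP[Hc _] sPc] := Sylow_subJ sylL sPC pPa.
  by exists (c * a)%g; rewrite ?groupM // conjsgM -sub_conjgV.
have sLK : (L / K) :^ c \subset (H / K)%g by rewrite -(conjGid Cc) conjSg quotientS.
have indP : #|H / K : P| = (#|G : D| * #|(L / K) :^ c : P|)%N.
  rewrite -(@Lagrange_index _ (H / K)%G ((L / K) :^ c)%G P) //; congr (_ * _)%N.
  by rewrite -indL -{1}(conjGid Cc) indexJg.
have sZ : Z \subset 'Z(H / K)%g by apply: subset_trans (quotientS K kZ) _; apply: morphim_center.
have [sZHK cZHK] := subsetIP sZ; have cHKZ : (H / K)%g \subset 'C(Z) by rewrite centsC.
have nsZ : Z <| (H / K)%g by apply: sub_center_normal.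
have abZ : abelian Z := subset_trans sZHK cHKZ.
have [l lb0] := constt_cfRes_irr Z b0.
have invl : 'I_(H / K)['chi_l] = (H / K)%g.
  by apply/setIidPl; apply: subset_trans (cent_sub_inertia _).
have Resl (b : Iirr (H / K)) : l \in irr_constt ('Res[Z] 'chi_b) ->
    forall z, z \in 'ker f -> 'chi_b (coset K z) = 'chi_b 1%g * 'chi_l (coset K z).
  move=> lb z kz; have Hz := subsetP (normal_sub (ker_normal f)) z kz.
  have Zz : coset K z \in Z by rewrite mem_quotient.
  have Rb := invariant_Res nsZ invl lb; set k := '[_, _] in Rb.
  have /(congr1 (fun phi : 'CF(Z) => phi (coset K z))) := Rb.
  have /(congr1 (fun phi : 'CF(Z) => phi 1%g)) := Rb.
  rewrite /= cfRes1 cfResE // !cfunE (lin_char1 (char_abelianP Z abZ l)) mulr1.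
  by move=> -> ->.
(* Agreeing with [b0] on [Z], [b] corresponds to a character in [B] over theta; subtracting the
   p-part of theta(1) from the height hypothesis gives the bound. *)
have degb b : b \in irr_block_over B0 l ->
   (logn p (Num.truncn ('chi_b 1%g)) <= logn p #|G : D|)%N.
  rewrite inE => /andP[B0b lb].
  have kerb z : z \in 'ker f -> 'chi_e z * 'chi_b (coset K z) = 'chi_e 1%g * 'chi_b 1%g.
    move=> kz; have Hz := subsetP (normal_sub (ker_normal f)) z kz.
    have := cb0 z Hz; rewrite (mker kz) (triple_corr_degree cb0) -triple_degree (Resl b0 lb0 z kz) => eb0.
    rewrite (Resl b lb z kz) mulrCA [in RHS]mulrC; congr (_ * _).
    by apply: (mulIf (irr1_neq0 b0)); rewrite eb0; ring.
  have [i cib ti] := triple_corr_irr kerb.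
  have Bi : i \in B.
    apply/(block_same maxM _ blB Bi0); apply: triple_corr_same_block cb0 cib _.
    by apply/(block_same maxM _ blB0 B0b0).
  have hti : height p D i = logn p (Num.truncn ('chi_t 1%g)) by apply: ht; rewrite inE Bi.
  have Dn : Num.truncn ('chi_i 1%g) = (Num.truncn ('chi_t 1%g) * Num.truncn ('chi_b 1%g))%N.
    by rewrite (triple_corr_degree cib) (irr1_truncn t) (irr1_truncn b) -natrM !natrK.
  have: (height p D i <= logn p (Num.truncn ('chi_t 1%g)))%N by rewrite hti.
  by rewrite /height Dn lognM ?truncn_irr1_gt0 // leq_subLR addnC leq_add2r.
have pZ : p.-group Z by apply: quotient_pgroup.
(* As [#|G : D|] divides [#|H / K : P|], the degree bound yields height zero for every character
   over [l]. *)
have [ab _] : abelian (P / Z) /\ extends_to P 'chi_l.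
  apply: (conjA _ _ p M B0 P Z l p_pr maxM blB0 defP pZ sZ).1 => b /degb le_b.
  apply/eqP; rewrite subn_eq0; apply: leq_trans le_b _.
  by rewrite dvdn_leq_log ?indexg_gt0 // indP dvdn_mulr.
(* Nonnegativity of the height of [b0] gives the reverse inequality, so [P] is the whole conjugate
   of L/K. *)
have b0l : b0 \in irr_block_over B0 l by rewrite inE B0b0.
have := leq_trans (logn_defect_le_degree p_pr maxM Hh (nMh b0 B0b0) sylP) (degb b0 b0l).
rewrite indP lognM ?indexg_gt0 // -[X in (_ <= X)%N]addn0 leq_add2l leqn0 => /eqP log0.
have sLP : (L / K) :^ c \subset P.
  rewrite -indexg_eq1; have pL : p.-nat #|((L / K) :^ c)%G : P|.
    by apply: pnat_dvd (dvdn_indexg _ _) _; rewrite cardJg; case/and3P: sylL.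
  by rewrite -(part_pnat_id pL) p_part log0.
have abL : abelian ((L / K) / Z).
  have nZc : c \in 'N(Z) by apply: subsetP Cc; apply: normal_norm.
  by rewrite -(abelianJ _ (coset Z c)) -quotientJ // (abelianS (quotientS Z sLP)).
have nKL := normal_norm nsKL.
have nZL : (L / K)%g \subset 'N(Z) by apply: subset_trans (quotientS _ sLH) (normal_norm nsZ).
have nND : D \subset 'N(N) by apply: subset_trans sDG (normal_norm morphim_K_normal).
(* The derived subgroup of [L] lies in K ker f, and applying [f] puts that of [D] in [N]. *)
move: abL; rewrite /abelian !quotient_cents2 // -quotientR // quotientSK; last first.
  by apply: subset_trans nKL; rewrite commg_subl normG.
move/(morphimS f); rewrite morphimR // morphpreK // morphimMl //.
move/subset_trans; apply; rewrite mul_subG //.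
by apply/subsetP=> _ /morphimP[z _ /mker fz ->]; rewrite fz group1.
Qed.

End Correspondence.

Theorem theorem2p2 (gT : finGroupType) (G N D : {group gT}) (p : nat)
    (M : {pred algC}) (t : Iirr N) (B : {set Iirr G}) :
  prime p -> max_ideal_over p M ->
  (N <| G)%g -> p.-group N ->
  'I_G['chi_t]%g = G ->
  is_block M B -> is_defect_group p M B D ->
  ((exists2 i, i \in irr_block_over B t &
       height p D i = logn p (Num.truncn ('chi_t 1%g))) ->
     extends_to D 'chi_t)
  /\
  (ConjectureA ->
     (forall i, i \in irr_block_over B t ->
        height p D i = logn p (Num.truncn ('chi_t 1%g))) ->
     abelian (D / N)).
Proof.
move=> p_pr maxM nsNG pN IG blB defD; split=> [[i] | conjA ht].
  have [x Gx [nMB _ sylD]] := defD; rewrite inE => /andP[Bi ti].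
  by move=> hti; apply: (extends_to_defect p_pr maxM nsNG pN IG ti Gx (nMB i Bi) sylD hti).
have irrY : mx_irreducible 'Chi_t by apply: socle_irr.
have [hT [H [K [f [e]]]]] := char_triple_extension nsNG IG irrY (irrRepr t) pN.
case=> [[fH kZ pk nsKH] [KI fK eK irrK ekI]].
have DG : G = (f @* H)%G by apply/val_inj.
have DN : N = (f @* K)%G by apply/val_inj.
subst G N.
exact: (triple_corr_defect_abelian kZ nsKH KI eK irrK ekI p_pr maxM pN pk conjA IG blB defD ht).
Qed.
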